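(* Let $A_n$ be a self-adjoint operator in a Hilbert space $\mathcal H_n$ for each $n\in\overline{\mathbb N}$ such that $(A_n)_{n\in\mathbb N}$ QUE-converges to $A_\infty$ at $z_0$ with convergence speed $(\delta_n)_n$. Then $(A_n)_{n\in\mathbb N}$ Weidmann-converges to $A_\infty$ at $z_0$ with a convergence speed $(\hat\delta_n)_n$ satisfying $$\hat\delta_n\le\widetilde\delta_n\bigl(1+(\|R_\infty\|+2\widetilde\delta_n)(2+3\widetilde\delta_n)\bigr)\in\mathrm O(\sqrt{\delta_n}),$$ where $R_\infty=(A_\infty-z_0)^{-1}$ and $$\widetilde\delta_n:=\delta_n^{1/2}\cdot\Bigl(2\bigl(\|R_\infty\|+2\delta_n\bigr)^{1/2}+\delta_n^{1/2}\Bigr)\in\mathrm O(\sqrt{\delta_n}).$$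
   Context: All Hilbert spaces are complex and separable; $\mathbb N=\{1,2,\dots\}$, $\overline{\mathbb N}=\mathbb N\cup\{\infty\}$; norms of operators are operator norms; $\rho(A)$ is the resolvent set. For $z_0\in\bigcap_{n\in\overline{\mathbb N}}\rho(A_n)$ write $R_n:=(A_n-z_0)^{-1}$, $n\in\overline{\mathbb N}$. Let $(\delta_n)_{n\in\mathbb N}$ be a sequence in $[0,\infty)$ with $\delta_n\to0$. $(A_n)_{n\in\mathbb N}$ Weidmann-converges to $A_\infty$ at $z_0$ with convergence speed $(\delta_n)_n$ if there exist a Hilbert space $\mathcal H$ and isometries $\iota_n:\mathcal H_n\to\mathcal H$ ($n\in\overline{\mathbb N}$) such that $\|\iota_nR_n\iota_n^*-\iota_\infty R_\infty\iota_\infty^*\|\le\delta_n$ for all $n\in\mathbb N$. $(A_n)_{n\in\mathbb N}$ QUE-converges to $A_\infty$ at $z_0$ with convergence speed $(\delta_n)_n$ if there exist bounded operators $J_n:\mathcal H_n\to\mathcal H_\infty$ ($n\in\mathbb N$; not necessarily contractions) such that for all $n\in\mathbb N$: (i) $\|J_n\|\le1+\delta_n$; (ii) $\|(\mathrm{id}_{\mathcal H_n}-J_n^*J_n)R_n\|\le\delta_n$ and $\|(\mathrm{id}_{\mathcal H_\infty}-J_nJ_n^* )R_\infty\|\le\delta_n$; (iii) $\|R_\infty J_n-J_nR_n\|\le\delta_n$; and, if $z_0\in\mathbb C\setminus\mathbb R$, (ii) and (iii) also hold with $R_n,R_\infty$ replaced by $R_n^*,R_\infty^*$. *)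

(* Defs.v *)
From HB Require Import structures.
From mathcomp Require Import all_boot all_order all_algebra complex.
From mathcomp Require Import all_classical all_reals all_analysis.
Import Order.TTheory GRing.Theory Num.Theory numFieldNormedType.Exports.

Set Implicit Arguments.
Unset Strict Implicit.
Unset Printing Implicit Defensive.

Local Open Scope classical_set_scope.
Local Open Scope ring_scope.
Local Open Scope complex_scope.

Definition separable (T : topologicalType) :=
  exists2 D : set T, countable D & dense D.

(* The inner product is linear in its first argument and conjugate-linear in
   its second one. *)
HB.mixin Record CompleteNormedModule_isHilbert (R : realType) V
    of CompleteNormedModule R[i] V := {
  inner : {dot V for (@Num.conj R[i])} ;
  inner_norm : forall x : V, inner x x = `|x| ^+ 2 ;
  hilbert_separable : separable V
}.

#[short(type="hilbertType")]
HB.structure Definition Hilbert (R : realType) :=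
  {V of CompleteNormedModule_isHilbert R V & CompleteNormedModule R[i] V}.

HB.structure Definition BoundedOp (R : realType) (V W : hilbertType R) :=
  {f of @GRing.Linear R[i] V W *:%R f & @isContinuous V W f}.

Notation "{ 'bounded' V -> W }" := (BoundedOp.type V%type W%type)
  (at level 0, V at level 98, W at level 99, format "{ 'bounded'  V  ->  W }").

Section bounded_operators.
Context {R : realType}.
Implicit Types U V W : hilbertType R.

HB.instance Definition _ U V W (f : {bounded V -> W}) (g : {bounded U -> V}) :=
  Continuous.on (f \o g).

HB.instance Definition _ V := Continuous.on (@idfun V).

Lemma sub_bounded_subproof V W (f g : {bounded V -> W}) :
  continuous (f \- g).
Proof.
by move=> x; exact: continuousB (@cts_fun _ _ f x) (@cts_fun _ _ g x).
Qed.

HB.instance Definition _ V W (f g : {bounded V -> W}) :=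
  isContinuous.Build V W (f \- g) (@sub_bounded_subproof V W f g).

Lemma null_bounded_subproof V W : continuous (\0 : V -> W).
Proof. by move=> x; exact: cvg_cst. Qed.

HB.instance Definition _ V W :=
  isContinuous.Build V W (\0 : V -> W) (@null_bounded_subproof V W).

Definition opnorm V W (f : {bounded V -> W}) : R :=
  sup [set complex.Re `|f x| | x in [set x : V | `|x| <= 1]].

Definition is_adjoint V W (f : {bounded V -> W}) (g : {bounded W -> V}) :=
  forall x y, inner (f x) y = inner x (g y).

(* The junk value [\0] is never taken, by the Riesz representation theorem. *)
Definition adjoint V W (f : {bounded V -> W}) : {bounded W -> V} :=
  if pselect (exists g, is_adjoint f g) is left ex then projT1 (cid ex)
  else (\0 : W -> V).

Definition is_isometry V W (f : {bounded V -> W}) := forall x, `|f x| = `|x|.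

End bounded_operators.

Record operator (R : realType) (V : hilbertType R) := Operator {
  dom : set V ;
  op :> V -> V ;
  dom0 : dom 0 ;
  domP : forall (a : R[i]) x y, dom x -> dom y -> dom (a *: x + y) ;
  opP : forall (a : R[i]) x y,
    dom x -> dom y -> op (a *: x + y) = a *: op x + op y
}.

Section unbounded_operators.
Context {R : realType} {V : hilbertType R}.
Implicit Types (A : operator V) (z : R[i]) (S : {bounded V -> V}).

(* The graph of the adjoint of a densely defined operator. *)
Definition adjoint_graph A : set (V * V) :=
  [set p | forall x, dom A x -> inner (A x) p.1 = inner x p.2].

Definition graph A : set (V * V) := [set p | dom A p.1 /\ p.2 = A p.1].

Definition self_adjoint A := dense (dom A) /\ adjoint_graph A = graph A.

Definition is_resolvent A z S :=
  (forall y, dom A (S y) /\ A (S y) - z *: S y = y) /\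
  (forall x, dom A x -> S (A x - z *: x) = x).

Definition resolvent_set A : set R[i] := [set z | exists S, is_resolvent A z S].

(* [(A - z)^-1] for [z] in the resolvent set, and [\0] otherwise. *)
Definition resolvent A z : {bounded V -> V} :=
  if pselect (exists S, is_resolvent A z S) is left ex then projT1 (cid ex)
  else (\0 : V -> V).

End unbounded_operators.

Section generalized_norm_resolvent_convergence.
Context {R : realType} (H : nat -> hilbertType R) (Hoo : hilbertType R).
Variables (A : forall n, operator (H n)) (Aoo : operator Hoo) (z0 : R[i]).
Variable delta : nat -> R.

Definition convergence_speed := (forall n, 0 <= delta n) /\ delta @ \oo --> 0.

Definition in_resolvent_sets :=
  (forall n, resolvent_set (A n) z0) /\ resolvent_set Aoo z0.

Local Notation R_ n := (resolvent (A n) z0).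
Local Notation Roo := (resolvent Aoo z0).

Definition Weidmann_converges :=
  [/\ convergence_speed, in_resolvent_sets &
    exists (K : hilbertType R) (iota : forall n, {bounded H n -> K})
        (iotaoo : {bounded Hoo -> K}),
      [/\ forall n, is_isometry (iota n), is_isometry iotaoo &
        forall n, opnorm ((iota n \o R_ n \o adjoint (iota n)) \-
                          (iotaoo \o Roo \o adjoint iotaoo)) <= delta n]].

Definition QUE_estimates n (J : {bounded H n -> Hoo})
    (S : {bounded H n -> H n}) (Soo : {bounded Hoo -> Hoo}) :=
  [/\ opnorm ((idfun \- (adjoint J \o J)) \o S) <= delta n,
      opnorm ((idfun \- (J \o adjoint J)) \o Soo) <= delta n &
      opnorm ((Soo \o J) \- (J \o S)) <= delta n].

Definition QUE_converges :=
  [/\ convergence_speed, in_resolvent_sets &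
    exists J : forall n, {bounded H n -> Hoo},
      forall n,
        [/\ opnorm (J n) <= 1 + delta n,
            QUE_estimates (J n) (R_ n) Roo &
            z0 \isn't Num.real ->
              QUE_estimates (J n) (adjoint (R_ n)) (adjoint Roo)]].

End generalized_norm_resolvent_convergence.

(* Main.v *)
(* Rescale J_n to the contraction P = J_n / (1 + delta_n) and complete it to an
   isometry x |-> (P x, W x) by a factorization W^* W = 1 - P^* P of its defect.
   All these isometries live in one parent space, the l2 sum of H_oo, embedded
   as the first summand, and of one auxiliary summand for each n.  In block
   form, the difference of the two lifted resolvents has the entry
   P R_n P^* - R_oo, of order delta_n by quasi-unitarity, and three further
   entries that all contain W R_n or its mirror image R_n W^* = (W R_n^* )^*.
   Since |W R_n x|^2 = |R_n x|^2 - |P R_n x|^2, these are of order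
   sqrt delta_n.  The estimates for R_n^* are part of the hypotheses when z0 is
   not real; for real z0 they hold because R_n is then self-adjoint. *)
From HB Require Import structures.
Require Import Defs.
From mathcomp Require Import all_boot all_order all_algebra complex ring lra.
From mathcomp Require Import all_classical all_reals all_analysis.
Import Order.TTheory GRing.Theory Num.Theory numFieldNormedType.Exports.

Set Implicit Arguments.
Unset Strict Implicit.
Unset Printing Implicit Defensive.

Local Open Scope classical_set_scope.
Local Open Scope ring_scope.
Local Open Scope complex_scope.

(** * Complex inner products presented by their real part *)

Section real_inner_product.
Context {R : realType} {V : lmodType R[i]} (r : V -> V -> R).

(** A complex inner product is determined by its real part, and limits of real series are simpler to
    handle. Invariance under ['i] is what allows the passage back to complex values. *)
Record real_inner_product := RealInnerProduct {
  realip_linear : forall (a : R) x y z, r (a%:C *: x + y) z = a * r x z + r y z;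
  realip_sym : forall x y, r x y = r y x;
  realip_i : forall x y, r ('i *: x) ('i *: y) = r x y;
  realip_ge0 : forall x, 0 <= r x x
}.

Hypothesis rP : real_inner_product.

Lemma realipDl x y z : r (x + y) z = r x z + r y z.
Proof. by have := realip_linear rP 1 x y z; rewrite scale1r mul1r. Qed.

Lemma realip0l z : r 0 z = 0.
Proof. by have := realipDl 0 0 z; rewrite addr0 => /eqP; lra. Qed.

Lemma realipZl (a : R) x z : r (a%:C *: x) z = a * r x z.
Proof. by have := realip_linear rP a x 0 z; rewrite realip0l !addr0. Qed.

Lemma realipNl x z : r (- x) z = - r x z.
Proof.
have := realipZl (-1) x z.
by rewrite (_ : (-1)%:C = -1 :> R[i]) ?scaleN1r ?mulN1r// rmorphN1.
Qed.

Lemma realipDr x y z : r x (y + z) = r x y + r x z.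
Proof. by rewrite (realip_sym rP) realipDl !(realip_sym rP _ x). Qed.

Lemma realipZr (a : R) x z : r x (a%:C *: z) = a * r x z.
Proof. by rewrite (realip_sym rP) realipZl (realip_sym rP x). Qed.

Lemma realipNr x z : r x (- z) = - r x z.
Proof. by rewrite (realip_sym rP) realipNl (realip_sym rP). Qed.

Lemma realip_CS x y : (r x y) ^+ 2 <= r x x * r y y.
Proof.
have q (t : R) : 0 <= t ^+ 2 * r x x + 2 * t * r x y + r y y.
  apply: le_trans (realip_ge0 rP (t%:C *: x + y)) _.
  rewrite realipDl !realipDr !realipZl !realipZr (realip_sym rP y x).
  by rewrite le_eqVlt; apply/orP; left; apply/eqP; ring.
have xge0 := realip_ge0 rP x; have yge0 := realip_ge0 rP y.
have [x0|xn0] := eqVneq (r x x) 0.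
  have [-> | xyn0] := eqVneq (r x y) 0; first by rewrite expr0n mulr_ge0.
  (* Here the polynomial of [q] is affine with nonzero slope, and this argument gives it the value
     -1. *)
  have := q (- (r y y + 1) / (2 * r x y)).
  rewrite x0 (_ : 2 * _ * _ = - (r y y + 1)); last by field.
  by rewrite mulr0 add0r => ?; exfalso; lra.
have x_gt0 : 0 < r x x by rewrite lt_def xn0.
(* The minimizer of the quadratic polynomial in [q]. *)
have := q (- r x y / r x x).
rewrite (_ : _ + _ = (r x x * r y y - r x y ^+ 2) / r x x); last by field.
by rewrite pmulr_lge0 ?invr_gt0// subr_ge0.
Qed.

Lemma realip_normD x y :
  Num.sqrt (r (x + y) (x + y)) <= Num.sqrt (r x x) + Num.sqrt (r y y).
Proof.
rewrite -(@ler_pXn2r _ 2) ?nnegrE ?addr_ge0 ?sqrtr_ge0//.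
rewrite sqrrD !sqr_sqrtr ?realip_ge0//.
rewrite realipDl !realipDr (realip_sym rP y x).
suff : r x y <= Num.sqrt (r x x) * Num.sqrt (r y y) by rewrite mulr2n; lra.
rewrite -sqrtrM ?realip_ge0// (le_trans (ler_norm _))// -sqrtr_sqr.
by rewrite ler_wsqrtr// realip_CS.
Qed.

Lemma realip_ii x : r x ('i *: x) = 0.
Proof.
have : r x ('i *: x) = - r x ('i *: x).
  rewrite -[in LHS](realip_i rP) scalerA -expr2 sqr_i scaleN1r realipNr.
  by rewrite (realip_sym rP).
by move=> ?; lra.
Qed.

Lemma realip_il x y : r ('i *: x) y = - r x ('i *: y).
Proof.
by rewrite -(realip_i rP) scalerA -expr2 sqr_i scaleN1r realipNl.
Qed.

Lemma realip_scale (l : R[i]) x y :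
  r (l *: x) y = complex.Re l * r x y - complex.Im l * r x ('i *: y).
Proof.
rewrite {1}(complexE l) scalerDl realipDl realipZl.
by rewrite [_%C * _%:C]mulrC -scalerA realipZl realip_il mulrN.
Qed.

Lemma realip_normZ (l : R[i]) x :
  (Num.sqrt (r (l *: x) (l *: x)))%:C = `|l| * (Num.sqrt (r x x))%:C.
Proof.
rewrite normc_def -rmorphM/= -sqrtrM ?addr_ge0 ?sqr_ge0//.
congr (Num.sqrt _)%:C.
rewrite realip_scale.
have -> : r x ('i *: (l *: x)) = - complex.Im l * r x x.
  rewrite scalerA mulrC -scalerA (realip_sym rP) realip_scale (realip_i rP).
  by rewrite (realip_sym rP) realip_ii mulr0 sub0r mulNr.
have -> : r x (l *: x) = complex.Re l * r x x.
  by rewrite (realip_sym rP) realip_scale realip_ii mulr0 subr0.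
by ring.
Qed.

(** For a form that is conjugate-linear in its second argument, the imaginary part of <x, y> is the
    real part of <x, i y>. *)
Definition complexip x y : R[i] := r x y +i* r x ('i *: y).

Lemma complexipDl x y z : complexip (x + y) z = complexip x z + complexip y z.
Proof. by rewrite /complexip !realipDl. Qed.

Lemma complexipZl (l : R[i]) x z : complexip (l *: x) z = l * complexip x z.
Proof.
rewrite /complexip !realip_scale scalerA -expr2 sqr_i scaleN1r realipNr.
by case: l => a b; simpc; congr (_ +i* _); ring.
Qed.

Lemma complexipC x y : complexip x y = (complexip y x)^*%C.
Proof.
rewrite /complexip/=; congr (_ +i* _); first exact: realip_sym.
by rewrite -realip_il (realip_sym rP).
Qed.

Lemma complexipxx x : complexip x x = (r x x)%:C.
Proof. by rewrite /complexip realip_ii. Qed.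

End real_inner_product.

(** * Real-valued norms on complex normed spaces *)

Section norms.
Context {R : realType}.

(** Norms over [R[i]] are complex numbers. Their real parts live in the ordered field [R], where
    suprema, square roots and [lra] are available. *)
Definition nrm (V : normedModType R[i]) (x : V) : R := complex.Re `|x|.

Lemma real_complex_gt0 (e : R[i]) : 0 < e -> exists2 a : R, 0 < a & e = a%:C.
Proof.
case: e => a b; rewrite ltcE/= => /andP[/eqP b0 a0]; exists a => //.
by rewrite b0.
Qed.

Section normed.
Context {V : normedModType R[i]}.
Implicit Types x y : V.

Lemma normE x : `|x| = (nrm x)%:C.
Proof. by rewrite /nrm RRe_real ?normr_real. Qed.

Lemma nrm_ge0 x : 0 <= nrm x.
Proof. by rewrite -ler0c -normE. Qed.

Lemma nrm0 : nrm (0 : V) = 0.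
Proof. by apply: complexI; rewrite -normE normr0. Qed.

Lemma nrm_eq0 x : nrm x = 0 -> x = 0.
Proof. by move=> x0; apply/normr0_eq0; rewrite normE x0. Qed.

Lemma nrmN x : nrm (- x) = nrm x.
Proof. by rewrite /nrm normrN. Qed.

Lemma nrmB x y : nrm (x - y) = nrm (y - x).
Proof. by rewrite /nrm distrC. Qed.

Lemma ler_nrmD x y : nrm (x + y) <= nrm x + nrm y.
Proof. by rewrite -lecR rmorphD/= -!normE ler_normD. Qed.

Lemma nrmZ (a : R) x : nrm (a%:C *: x) = `|a| * nrm x.
Proof.
apply: complexI; rewrite -normE normrZ normE rmorphM/=; congr (_ * _).
by rewrite normc_def/= expr0n addr0 sqrtr_sqr.
Qed.

Lemma nrmZc (a : R[i]) x : nrm (a *: x) = complex.Re `|a| * nrm x.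
Proof.
apply: complexI; rewrite -normE normrZ normE rmorphM/=.
by rewrite [X in X * _](_ : _ = (complex.Re `|a|)%:C)// RRe_real ?normr_real.
Qed.

Lemma nrmD2 x y : nrm (x + y) ^+ 2 <= 2 * nrm x ^+ 2 + 2 * nrm y ^+ 2.
Proof.
have xy := ler_nrmD x y; have h := nrm_ge0 (x + y).
apply: (@le_trans _ _ ((nrm x + nrm y) ^+ 2)).
  by rewrite ler_pXn2r ?nnegrE ?addr_ge0 ?nrm_ge0.
by have := sqr_ge0 (nrm x - nrm y); lra.
Qed.

Lemma ball_nrm x (a : R) : ball x a%:C = [set y | nrm (x - y) < a].
Proof.
by apply/seteqP; split => y; rewrite -ball_normE /ball_/= normE ltcR.
Qed.

End normed.

Lemma nrm_cauchy_cvg (V : completeNormedModType R[i]) (x : nat -> V) :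
  (forall e : R, 0 < e -> exists N, forall m n, (N <= m)%N -> (N <= n)%N ->
     nrm (x m - x n) < e) ->
  exists l, (fun n => nrm (x n - l)) @ \oo --> 0.
Proof.
move=> xC; have /cauchy_cvg/cvg_ex[l xl] : cauchy (x @ \oo).
  apply/cauchy_ballP => e /real_complex_gt0[a a0 ->].
  have [N xN] := xC _ a0; rewrite near_map2/=.
  exists ([set n | (N <= n)%N], [set n | (N <= n)%N]) => /=.
    by split; exists N.
  by move=> [m n] /= [Nm Nn]; rewrite ball_nrm/=; exact: xN.
exists l; apply/cvgr0Pnorm_lt => e e0.
have : \forall n \near \oo, ball l e%:C (x n).
  by apply: xl; apply: nbhsx_ballx; rewrite ltcR.
by apply: filterS => n; rewrite ball_nrm/= nrmB ger0_norm ?nrm_ge0.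
Qed.

Lemma linear_nrm_continuous (V W : normedModType R[i]) (f : {linear V -> W})
    (c : R) : (forall x, nrm (f x) <= c * nrm x) -> continuous f.
Proof.
move=> fc; apply/linear_bounded_continuous/linear_boundedP.
near=> r => x; rewrite !normE.
(* Close to +oo in [R[i]], numbers are real and exceed any given real number. *)
have -> : r = (complex.Re r)%:C.
  by rewrite RRe_real//; near: r; exact: nbhs_pinfty_real.
rewrite -rmorphM lecR (le_trans (fc x))// ler_wpM2r ?nrm_ge0//.
have : c%:C <= r.
  by near: r; apply: nbhs_pinfty_ge; apply/complex_realP; exists c.
by rewrite lecE => /andP[].
Unshelve. all: by end_near. Qed.

Lemma continuous_linear_nrm (V W : normedModType R[i]) (f : {linear V -> W}) :
  continuous f -> exists c, forall x, nrm (f x) <= c * nrm x.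
Proof.
move=> /linear_bounded_continuous/linear_boundedP/pinfty_ex_gt0[r r0 fr].
move: r0 fr => /real_complex_gt0[c _ ->] fc; exists c => x.
by have := fc x; rewrite !normE -rmorphM lecR.
Qed.

End norms.

(** * The real part of the inner product of a Hilbert space *)

Section inner_product.
Context {R : realType} {V : hilbertType R}.
Implicit Types x y z : V.

Definition rip x y : R := complex.Re (inner x y).

Lemma innerC x y : inner x y = (inner y x)^*%C.
Proof. by rewrite [LHS]hermC expr0 mul1r. Qed.

Lemma innerDl x y z : inner (x + y) z = inner x z + inner y z.
Proof. exact: linearDl. Qed.

Lemma innerZl a x z : inner (a *: x) z = a * inner x z.
Proof. exact: linearZl_LR. Qed.

Lemma innerZr a x z : inner x (a *: z) = a^*%C * inner x z.
Proof. by rewrite innerC innerZl rmorphM/= [in RHS]innerC. Qed.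

Lemma rip_real : real_inner_product rip.
Proof.
split.
- move=> a x y z; rewrite /rip innerDl innerZl.
  by case: (inner x z) => ? ?; case: (inner y z) => ? ?; simpc.
- by move=> x y; rewrite /rip innerC; case: (inner y x).
- move=> x y; rewrite /rip innerZl innerZr.
  by case: (inner x y) => ? ?; simpc.
- by move=> x; rewrite /rip inner_norm normE -rmorphXn/= sqr_ge0.
Qed.

Lemma innerE x y : inner x y = rip x y +i* rip x ('i *: y).
Proof. by rewrite /rip innerZr; case: (inner x y) => a b; simpc. Qed.

Lemma ripxx x : rip x x = nrm x ^+ 2.
Proof. by rewrite /rip inner_norm normE -rmorphXn. Qed.

Lemma ler_rip x y : `|rip x y| <= nrm x * nrm y.
Proof.
rewrite -(@ler_pXn2r _ 2) ?nnegrE ?mulr_ge0 ?nrm_ge0//.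
by rewrite real_normK ?num_real// exprMn -!ripxx realip_CS//; exact: rip_real.
Qed.

Definition ripDl := realipDl rip_real.
Definition ripDr := realipDr rip_real.
Definition ripNl := realipNl rip_real.
Definition ripNr := realipNr rip_real.
Definition ripZl := realipZl rip_real.
Definition ripZr := realipZr rip_real.
Definition ripC := realip_sym rip_real.

Lemma nrmDsqr x y : nrm (x + y) ^+ 2 = nrm x ^+ 2 + 2 * rip x y + nrm y ^+ 2.
Proof. by rewrite -!ripxx ripDl !ripDr (ripC y); ring. Qed.

(** Testing with [y = x] gives [|x|^2 <= c |x|]. Bounds pass from operators to their adjoints in
    this way. *)
Lemma nrm_le_rip x (c : R) : 0 <= c ->
  (forall y, rip x y <= c * nrm y) -> nrm x <= c.
Proof.
move=> c0 /(_ x); rewrite ripxx => xc.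
have [->//|x0] := eqVneq (nrm x) 0.
by rewrite -(ler_pM2r (_ : 0 < nrm x)) -?expr2// lt_def x0 nrm_ge0.
Qed.

Lemma rip_ext x y : (forall z, rip x z = rip y z) -> x = y.
Proof.
move=> xy; apply/eqP; rewrite -subr_eq0; apply/eqP/nrm_eq0/eqP.
by rewrite -sqrf_eq0 -ripxx ripDl ripNl xy subrr.
Qed.

End inner_product.

(** * The l2 direct sum of Hilbert spaces *)

Section l2_sum.
Context {R : realType} (E : nat -> hilbertType R).

Definition sqseries (f : forall n, E n) : R^nat :=
  series (fun i => nrm (f i) ^+ 2).

(** Square summability is encoded by bounded partial sums, so that closure under the vector space
    operations is checked on finite sums. *)
Record l2 := L2 {
  l2fun :> forall n, E n ;
  l2P : exists M, forall N, sqseries l2fun N <= M }.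

Implicit Types f g h : l2.

Lemma l2_ext f g : (forall n, f n = g n) -> f = g.
Proof.
case: f g => f fP [g gP]/= fg.
have {}fg : f = g by exact: functional_extensionality_dep.
by subst g; congr L2; exact: Prop_irrelevance.
Qed.

Lemma l2_add_subproof f g :
  exists M, forall N, sqseries (fun n => f n + g n) N <= M.
Proof.
have [[M fM] [M' gM]] := (l2P f, l2P g); exists (2 * M + 2 * M') => N.
apply: (@le_trans _ _ (2 * sqseries f N + 2 * sqseries g N)).
  rewrite /sqseries /series/= !mulr_sumr -big_split/=; apply: ler_sum => i _.
  exact: nrmD2.
by rewrite lerD// ler_pM2l.
Qed.

Lemma l2_scale_subproof (a : R[i]) f :
  exists M, forall N, sqseries (fun n => a *: f n) N <= M.
Proof.
have [M fM] := l2P f; exists (complex.Re `|a| ^+ 2 * M) => N.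
rewrite (_ : sqseries _ _ = complex.Re `|a| ^+ 2 * sqseries f N).
  by rewrite ler_wpM2l ?sqr_ge0.
rewrite /sqseries /series/= mulr_sumr; apply: eq_bigr => i _.
by rewrite nrmZc exprMn.
Qed.

Lemma l2_zero_subproof : exists M, forall N, sqseries (fun n => 0 : E n) N <= M.
Proof.
exists 0 => N; rewrite /sqseries /series/= big1// => i _.
by rewrite nrm0 expr0n.
Qed.

Lemma l2_opp_subproof f :
  exists M, forall N, sqseries (fun n => - f n) N <= M.
Proof.
have [M fM] := l2P f; exists M => N; apply: le_trans (fM N).
by rewrite /sqseries /series/=; apply: ler_sum => i _; rewrite nrmN.
Qed.

HB.instance Definition _ := gen_eqMixin l2.
HB.instance Definition _ := gen_choiceMixin l2.

Let l2_add f g := L2 (l2_add_subproof f g).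
Let l2_opp f := L2 (l2_opp_subproof f).
Let l2_zero := L2 l2_zero_subproof.
Let l2_scale a f := L2 (l2_scale_subproof a f).

Let l2_addA : associative l2_add.
Proof. by move=> f g h; apply: l2_ext => n /=; rewrite addrA. Qed.
Let l2_addC : commutative l2_add.
Proof. by move=> f g; apply: l2_ext => n /=; rewrite addrC. Qed.
Let l2_add0 : left_id l2_zero l2_add.
Proof. by move=> f; apply: l2_ext => n /=; rewrite add0r. Qed.
Let l2_addN : left_inverse l2_zero l2_opp l2_add.
Proof. by move=> f; apply: l2_ext => n /=; rewrite addNr. Qed.

HB.instance Definition _ :=
  GRing.isZmodule.Build l2 l2_addA l2_addC l2_add0 l2_addN.

Let l2_scaleA a b f : l2_scale a (l2_scale b f) = l2_scale (a * b) f.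
Proof. by apply: l2_ext => n /=; rewrite scalerA. Qed.
Let l2_scale1 : left_id 1 l2_scale.
Proof. by move=> f; apply: l2_ext => n /=; rewrite scale1r. Qed.
Let l2_scaleDr : right_distributive l2_scale +%R.
Proof. by move=> a f g; apply: l2_ext => n /=; rewrite scalerDr. Qed.
Let l2_scaleDl f : {morph l2_scale^~ f : a b / a + b}.
Proof. by move=> a b; apply: l2_ext => n /=; rewrite scalerDl. Qed.

HB.instance Definition _ := GRing.Zmodule_isLmodule.Build R[i] l2
  l2_scaleA l2_scale1 l2_scaleDr l2_scaleDl.

Lemma l2DE f g n : (f + g) n = f n + g n. Proof. by []. Qed.
Lemma l2ZE a f n : (a *: f) n = a *: f n. Proof. by []. Qed.
Lemma l2BE f g n : (f - g) n = f n - g n. Proof. by []. Qed.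

Lemma sqseries_nd (f : forall n, E n) : nondecreasing_seq (sqseries f).
Proof. by apply/nondecreasing_series => n _ _; exact: sqr_ge0. Qed.

Lemma is_cvg_sqseries f : cvgn (sqseries f).
Proof.
apply: nondecreasing_is_cvgn; first exact: sqseries_nd.
by have [M fM] := l2P f; exists M => _ [n _ <-].
Qed.

Definition lip f g : R := limn (series (fun i => rip (f i) (g i))).

Lemma is_cvg_lip f g : cvgn (series (fun i => rip (f i) (g i))).
Proof.
(* Polarization writes the series as a combination of three convergent ones. *)
rewrite (_ : series _ =
    2^-1 \*: ((sqseries (f + g) - sqseries f) - sqseries g)).
  by apply: is_cvgZr; do 2 (apply: is_cvgB; last exact: is_cvg_sqseries);
    exact: is_cvg_sqseries.
apply/funext => N; rewrite /sqseries /series /=.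
transitivity (2^-1 * (\sum_(0 <= k < N) nrm ((f + g) k) ^+ 2 -
  \sum_(0 <= k < N) nrm (f k) ^+ 2 - \sum_(0 <= k < N) nrm (g k) ^+ 2)) => //.
rewrite -!sumrB mulr_sumr; apply: eq_bigr => i _.
by rewrite l2DE nrmDsqr; field.
Qed.

Lemma lip_real : real_inner_product lip.
Proof.
split.
- move=> a f g h; rewrite /lip.
  rewrite (_ : series _ = a \*: series (fun i => rip (f i) (h i)) +
    series (fun i => rip (g i) (h i))).
    rewrite limD ?limZr//; try exact: is_cvg_lip.
    by apply: cvgZr; exact: is_cvg_lip.
  apply/funext => N; rewrite /series/= fctE/= scaler_sumr -big_split/=.
  by apply: eq_bigr => i _; rewrite ripDl ripZl.
- by move=> f g; congr (limn (series _)); apply/funext => i; exact: ripC.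
- move=> f g; congr (limn (series _)); apply/funext => i.
  by rewrite !l2ZE (realip_i rip_real).
- move=> f; apply: limr_ge; first exact: is_cvg_lip.
  by apply: nearW => n; apply: sumr_ge0 => i _; rewrite ripxx sqr_ge0.
Qed.

Lemma lip_sq f : lip f f = limn (sqseries f).
Proof. by congr (limn (series _)); apply/funext => i; rewrite ripxx. Qed.

Lemma sqseries_le f N : sqseries f N <= lip f f.
Proof.
rewrite lip_sq; apply: nondecreasing_cvgn_le; first exact: sqseries_nd.
exact: is_cvg_sqseries.
Qed.

Lemma lip_ub f M : (forall N, sqseries f N <= M) -> lip f f <= M.
Proof.
move=> fM; rewrite lip_sq; apply: limr_le; first exact: is_cvg_sqseries.
exact: nearW.
Qed.

Lemma coord_le_lip f n : nrm (f n) ^+ 2 <= lip f f.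
Proof.
apply: le_trans (sqseries_le f n.+1).
rewrite /sqseries /series/= big_nat_recr//= lerDr.
by apply: sumr_ge0 => i _; exact: sqr_ge0.
Qed.

Let l2_norm f : R[i] := (Num.sqrt (lip f f))%:C.

Let l2_normD f g : l2_norm (f + g) <= l2_norm f + l2_norm g.
Proof. by rewrite -rmorphD lecR realip_normD//; exact: lip_real. Qed.

Let l2_normZ a f : l2_norm (a *: f) = `|a| * l2_norm f.
Proof. exact: realip_normZ lip_real _ _. Qed.

Let l2_norm0 f : l2_norm f = 0 -> f = 0.
Proof.
move=> /complexI/eqP; rewrite sqrtr_eq0 => f0; apply: l2_ext => n.
apply/nrm_eq0/eqP; rewrite -sqrf_eq0 eq_le sqr_ge0 andbT.
exact: le_trans (coord_le_lip f n) f0.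
Qed.

HB.instance Definition _ :=
  Lmodule_isNormed.Build R[i] l2 l2_normD l2_normZ l2_norm0.

Lemma l2_nrm f : nrm f = Num.sqrt (lip f f).
Proof. by []. Qed.

Lemma l2_nrm2 f : nrm f ^+ 2 = lip f f.
Proof. by rewrite l2_nrm sqr_sqrtr// (realip_ge0 lip_real). Qed.

Lemma coord_le_nrm f n : nrm (f n) <= nrm f.
Proof.
rewrite -(@ler_pXn2r _ 2) ?nnegrE ?nrm_ge0// l2_nrm2.
exact: coord_le_lip.
Qed.

End l2_sum.

Lemma cauchy_nrm (R : realType) (V : normedModType R[i]) (F : set_system V)
    (FF : ProperFilter F) :
  cauchy F <-> forall e : R, 0 < e ->
    exists2 A, F A & forall x y, A x -> A y -> nrm (x - y) < e.
Proof.
split=> [/cauchy_ballP FC e e0|FC].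
  have /FC : 0 < e%:C by rewrite ltcR.
  rewrite near_simpl => -[[A B] /= [FA FB] AB].
  exists (A `&` B); first exact: filterI.
  move=> x y [Ax _] [_ By].
  by have := AB (x, y) (conj Ax By); rewrite /= ball_nrm.
apply/cauchy_ballP => e /real_complex_gt0[a a0 ->].
have [A FA AC] := FC _ a0; exists (A, A) => //= -[x y] [/= Ax Ay].
by rewrite ball_nrm; exact: AC.
Qed.

Lemma cvg_nrm (R : realType) (V : normedModType R[i]) (T : Type)
    (F : set_system T) (FF : Filter F) (f : T -> V) (l : V) :
  f @ F --> l -> (fun t => nrm (f t)) @ F --> nrm l.
Proof.
move=> fl; apply/cvgrPdist_lt => e e0.
have : \forall t \near F, ball l e%:C (f t).
  by apply: fl; apply: nbhsx_ballx; rewrite ltcR.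
apply: filterS => t; rewrite ball_nrm/=; apply: le_lt_trans.
have h1 := ler_nrmD (l - f t) (f t); rewrite subrK in h1.
have h2 := ler_nrmD (f t - l) l; rewrite subrK nrmB in h2.
by rewrite ler_norml; apply/andP; split; lra.
Qed.

(** * Completeness, inner product and coordinate injections of the l2 sum *)

Section l2_hilbert.
Context {R : realType} (E : nat -> hilbertType R).
Local Notation l2 := (l2 E).
Implicit Types f g h : l2.

(** The limit [g] is taken coordinatewise. For [f] in a set of [F] of small diameter, each partial
    sum of [|f - h|^2] passes to the limit in [h], and the resulting bound is uniform in the number
    of terms. *)
Let l2_cauchy_cvg (F : set_system l2) : ProperFilter F -> cauchy F -> cvg F.
Proof.
move=> FF /cauchy_nrm FC.
have FCn n : cvg ((fun f : l2 => f n) @ F).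
  apply: cauchy_cvg; apply/cauchy_nrm => e /FC[A FA AC].
  exists [set (h : l2) n | h in A].
    by apply: (@filterS _ F _ A) => // f Af; exists f.
  move=> _ _ [f Af <-] [h Ah <-]; rewrite -l2BE.
  exact: le_lt_trans (coord_le_nrm _ _) (AC _ _ Af Ah).
pose g n := lim ((fun f : l2 => f n) @ F).
have fg e A f : (forall x y, A x -> A y -> nrm (x - y) < e) -> F A -> A f ->
    forall N, sqseries (fun n => f n - g n) N <= e ^+ 2.
  move=> AC FA Af N.
  have : (fun h : l2 => sqseries (f - h) N) @ F -->
      sqseries (fun n => f n - g n) N.
    apply: cvg_big => [|i _]; [exact: add_continuous|rewrite expr2].
    by apply: cvgM; apply: cvg_nrm; apply: cvgB; [exact: cvg_cst|exact: FCn|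
      exact: cvg_cst|exact: FCn].
  move/cvgr_to_le; apply; apply: filterS FA => h Ah.
  apply: le_trans (sqseries_le _ _) _.
  have fh := AC _ _ Af Ah.
  rewrite -l2_nrm2 ler_pXn2r ?nnegrE ?nrm_ge0 ?ltW//.
  by rewrite (le_lt_trans _ fh) ?nrm_ge0.
(* Diameter 1 is enough to see that [g = f0 - (f0 - g)] is square summable. *)
have [A FA AC] := FC 1 ltr01.
have [f0 Af0] := filter_ex FA.
have gP : exists M, forall N, sqseries g N <= M.
  have [M f0M] := l2P f0; exists (2 * M + 2 * 1 ^+ 2) => N.
  apply: (@le_trans _ _
    (2 * sqseries f0 N + 2 * sqseries (fun n => f0 n - g n) N)).
    rewrite /sqseries /series/= !mulr_sumr -big_split/=; apply: ler_sum => i _.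
    rewrite (_ : nrm (g i) = nrm (f0 i + - (f0 i - g i))); last first.
      by rewrite opprB addrCA subrr addr0.
    by apply: le_trans (nrmD2 _ _) _; rewrite nrmN.
  by rewrite lerD// ler_pM2l// (fg _ _ _ AC).
apply/cvg_ex; exists (L2 gP).
move=> B /nbhs_ballP[e /= /real_complex_gt0[a a0 ->]]; rewrite ball_nrm => aB.
(* The limit only yields weak inequalities; half the radius restores a strict one. *)
have a20 : 0 < a / 2 by rewrite divr_gt0.
have [C FS CC] := FC _ a20; have Cg := fg _ _ _ CC FS.
apply: filterS FS => f Cf; apply: aB => /=; rewrite nrmB.
apply: (@le_lt_trans _ _ (a / 2)); last by lra.
rewrite -(@ler_pXn2r _ 2) ?nnegrE ?nrm_ge0 ?(ltW a20)// l2_nrm2.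
apply: lip_ub => N; exact: Cg.
Qed.

HB.instance Definition _ := Uniform_isComplete.Build l2 l2_cauchy_cvg.

Definition linner : l2 -> l2 -> R[i] := complexip (@lip R E).

Let lreal := @lip_real R E.

Let linnerBl g : zmod_morphism (linner^~ g).
Proof.
move=> f h; rewrite /linner complexipDl//; congr (_ + _).
by rewrite -scaleN1r complexipZl// mulN1r.
Qed.

Let linnerZl g : scalable_for *%R (linner^~ g).
Proof. by move=> a f; exact: complexipZl. Qed.

Let linner_conj f g : linner f g = (linner g f)^*%C.
Proof. exact: complexipC. Qed.

Let linnerBr g : zmod_morphism (linner g).
Proof.
move=> f h; rewrite linner_conj (linnerBl g) rmorphB/=.
by rewrite (linner_conj g f) (linner_conj g h).
Qed.

Let linnerZr g : scalable_for (@Num.conj R[i] \; *%R) (linner g).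
Proof.
by move=> a f; rewrite linner_conj linnerZl rmorphM/= (linner_conj g).
Qed.

HB.instance Definition _ := isBilinear.Build R[i] l2 l2 R[i] *%R
  (@Num.conj R[i] \; *%R) linner linnerBl linnerBr linnerZl linnerZr.

Let linnerC f g : linner f g = (-1) ^+ false * Num.conj (linner g f).
Proof. by rewrite expr0 mul1r linner_conj. Qed.

HB.instance Definition _ := isHermitianSesquilinear.Build R[i] l2 false
  (@Num.conj R[i]) linner linnerC.

Lemma linnerE f : linner f f = `|f| ^+ 2.
Proof. by rewrite /linner complexipxx// normE -rmorphXn/= l2_nrm2. Qed.

Let linner_gt0 f : f != 0 -> 0 < linner f f.
Proof. by move=> f0; rewrite linnerE exprn_gt0// normr_gt0. Qed.

HB.instance Definition _ := isDotProduct.Build R[i] l2 linner linner_gt0.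


Lemma l2_inj_subproof n (x : E n) :
  exists M, forall N, sqseries (dfwith (fun k => 0 : E k) n x) N <= M.
Proof.
exists (nrm x ^+ 2); elim => [|N IH].
  by rewrite /sqseries /series/= big_nil sqr_ge0.
have [->|nN] := eqVneq N n.
  rewrite /sqseries /series/= big_nat_recr//= dfwithin big_nat big1 ?add0r//.
  move=> i /andP[_ iN]; rewrite dfwithout ?nrm0 ?expr0n//.
  by apply/eqP => ni; move: iN; rewrite ni ltnn.
move: IH; rewrite /sqseries /series/= big_nat_recr//=.
rewrite dfwithout ?nrm0 ?expr0n/= ?addr0//.
by rewrite eq_sym.
Qed.

Definition l2_inj n (x : E n) : l2 := L2 (l2_inj_subproof x).

Lemma l2_injE n (x : E n) : l2_inj x n = x.
Proof. exact: dfwithin. Qed.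

Lemma l2_inj_neq n (x : E n) m : m != n -> l2_inj x m = 0.
Proof. by move=> mn; rewrite /l2_inj/= dfwithout// eq_sym. Qed.

Lemma l2_injP n (a : R[i]) (x y : E n) :
  l2_inj (a *: x + y) = a *: l2_inj x + l2_inj y.
Proof.
apply: l2_ext => m; rewrite l2DE l2ZE; have [mn|mn] := eqVneq m n.
  by subst m; rewrite !l2_injE.
by rewrite !l2_inj_neq// scaler0 addr0.
Qed.

Lemma lip_inj n (x : E n) f : lip (l2_inj x) f = rip x (f n).
Proof.
(* With [x] written as the [n]-th coordinate of [u], the partial sums are constant from [n.+1] on
   because [u] vanishes at all other indices. *)
rewrite -[in RHS](l2_injE x).
have u0 := @l2_inj_neq n x; move: (l2_inj x) u0 => u u0 {x}.
rewrite /lip; apply/cvg_lim => //; apply: cvg_near_cst.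
exists n.+1 => // N /= nN; rewrite /series/=.
rewrite (big_cat_nat (n := n.+1))//= big_nat_recr//=.
rewrite [X in X + _ + _]big_nat [X in X + _ + _]big1 ?add0r; last first.
  by move=> i /andP[_ iN]; rewrite u0 ?(realip0l rip_real)// ltn_eqF.
rewrite [X in _ + X]big_nat [X in _ + X]big1 ?addr0// => i /andP[ni _].
by rewrite u0 ?(realip0l rip_real)// gtn_eqF.
Qed.

Lemma nrm_l2_inj n (x : E n) : nrm (l2_inj x) = nrm x.
Proof.
by rewrite l2_nrm lip_inj l2_injE ripxx sqrtr_sqr ger0_norm ?nrm_ge0.
Qed.

Definition l2_trunc N f : l2 := \sum_(0 <= k < N) l2_inj (f k).

Lemma l2_truncE N f n : (n < N)%N -> l2_trunc N f n = f n.
Proof.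
move=> nN; have -> : l2_trunc N f n = \sum_(0 <= k < N) l2_inj (f k) n.
  rewrite /l2_trunc; elim: N {nN} => [|N IH]; first by rewrite !big_nil.
  by rewrite !big_nat_recr// l2DE IH.
rewrite (bigD1_seq n) ?mem_index_iota ?iota_uniq// l2_injE big1 => [|k kn].
  exact: addr0.
by rewrite l2_inj_neq// eq_sym.
Qed.

(** By Pythagoras, the square of this norm is [lip f f] minus the [N]-th partial sum of its
    series. *)
Lemma l2_trunc_cvg f : (fun N => nrm (f - l2_trunc N f)) @ \oo --> 0.
Proof.
have lT N h : lip (l2_trunc N f) h = \sum_(0 <= k < N) rip (f k) (h k).
  rewrite /l2_trunc; elim: N => [|N IH].
    by rewrite !big_nil (realip0l lreal).
  by rewrite !big_nat_recr//= (realipDl lreal) IH lip_inj.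
have fN N : nrm (f - l2_trunc N f) = Num.sqrt (lip f f - sqseries f N).
  rewrite l2_nrm; congr Num.sqrt.
  rewrite (realipDl lreal) (realipNl lreal) !(realipDr lreal) !(realipNr lreal).
  rewrite (realip_sym lreal f (l2_trunc N f)) !lT.
  rewrite (_ : \sum_(0 <= k < N) rip (f k) (l2_trunc N f k) =
      sqseries f N); last first.
    rewrite /sqseries/series/=; apply: eq_big_nat => k /andP[_ kN].
    by rewrite l2_truncE// ripxx.
  rewrite (_ : \sum_(0 <= k < N) rip (f k) (f k) = sqseries f N); last first.
    by apply: eq_bigr => k _; rewrite ripxx.
  by ring.
rewrite (funext fN) -(sqrtr0 R) -(subrr (lip f f)).
apply: (@continuous_cvg _ _ _ _ _ _ Num.sqrt); first exact: sqrt_continuous.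
apply: cvgB; first exact: cvg_cst.
by rewrite lip_sq; exact: is_cvg_sqseries.
Qed.

End l2_hilbert.

(** * Separability of the l2 sum *)

Section l2_separable.
Context {R : realType} (E : nat -> hilbertType R).
Local Notation l2 := (l2 E).
Implicit Types f g h : l2.

Lemma dense_nrmP (V : normedModType R[i]) (D : set V) :
  dense D <-> forall x (e : R), 0 < e -> exists2 y, D y & nrm (x - y) < e.
Proof.
split=> [dD x e e0|dD O [x Ox] oO].
  have [||y] := dD (ball x e%:C); last by rewrite ball_nrm => -[]; exists y.
    by exists x; rewrite ball_nrm/= subrr nrm0.
  by apply: ball_open; rewrite ltcR.
have /nbhs_ballP[e /= /real_complex_gt0[a a0 ->]] :=
  open_nbhs_nbhs (conj oO Ox).
rewrite ball_nrm => aO; have [y Dy xy] := dD x a a0.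
by exists y; split => //; exact: aO.
Qed.

Let D n : set (E n) := sval (cid2 (@hilbert_separable R (E n))).

Let D_countable n : countable (@D n).
Proof. by rewrite /D; case: cid2. Qed.

Let D_dense n : dense (@D n).
Proof. by rewrite /D; case: cid2. Qed.

(** Vectors supported on the first [N] summands, with coordinates in the chosen countable dense
    sets. The recursion presents each stage as the image of a product of two countable sets. *)
Let finsupp : nat -> set l2 := fix F N :=
  if N is N'.+1 then
    (fun p : l2 * E N' => p.1 + l2_inj p.2) @` (F N' `*` @D N')
  else [set 0].

Let finsupp_countable N : countable (finsupp N).
Proof.
elim: N => [|N IH] /=; first exact: countable1.
apply: sub_countable (card_image_le _ _) _.
exact: countableX.
Qed.

Let finsupp_trunc N f (e : R) : 0 < e ->
  exists2 g, finsupp N g & nrm (l2_trunc N f - g) < e.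
Proof.
elim: N e => [|N IH] e e0.
  by exists 0 => //; rewrite /l2_trunc big_nil subr0 nrm0.
have e20 : 0 < e / 2 by rewrite divr_gt0.
have [g gN fg] := IH _ e20.
have /dense_nrmP/(_ (f N) _ e20)[x Dx fx] := @D_dense N.
exists (g + l2_inj x); first by exists (g, x).
rewrite /l2_trunc big_nat_recr// -/(l2_trunc N f) opprD addrACA.
have -> : l2_inj (f N) - l2_inj x = l2_inj (f N - x) :> l2.
  by rewrite addrC -scaleN1r -l2_injP scaleN1r addrC.
apply: le_lt_trans (ler_nrmD _ _) _; rewrite nrm_l2_inj.
by rewrite [ltRHS](splitr e) ltrD.
Qed.

Lemma l2_separable : separable l2.
Proof.
exists (\bigcup_N finsupp N).
  by apply: bigcup_countable => // N _; exact: finsupp_countable.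
apply/dense_nrmP => f e e0.
have e20 : 0 < e / 2 by rewrite divr_gt0.
have /cvgr0Pnorm_lt/(_ _ e20)[N _ /(_ N (leqnn N))] := @l2_trunc_cvg _ _ f.
rewrite ger0_norm ?nrm_ge0// => fN.
have [g gN Ng] := finsupp_trunc N f e20.
exists g; first by exists N.
rewrite -(subrK (l2_trunc N f) f) -addrA.
apply: le_lt_trans (ler_nrmD _ _) _.
by rewrite [ltRHS](splitr e) ltrD.
Qed.

HB.instance Definition _ := CompleteNormedModule_isHilbert.Build R l2
  (@linnerE R E) l2_separable.

End l2_separable.

Lemma l2_rip (R : realType) (E : nat -> hilbertType R) (f g : l2 E) :
  rip f g = lip f g.
Proof. by []. Qed.

(** * Operator norms, Riesz representation and adjoints *)

Section bounded_operators.
Context {R : realType}.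
Implicit Types V W : hilbertType R.

(** The norm estimate supplies continuity. The intermediate [fL] is there because the continuity
    lemma expects an already bundled linear map. *)
Definition bounded_of V W (f : V -> W) (fl : linear f) (c : R)
    (fc : forall x, nrm (f x) <= c * nrm x) : {bounded V -> W} :=
  let fL : {linear V -> W} := HB.pack f (GRing.isLinear.Build _ _ _ _ f fl) in
  HB.pack f (GRing.isLinear.Build _ _ _ _ f fl)
    (isContinuous.Build V W f (@linear_nrm_continuous R V W fL c fc)).

Lemma bounded_ofE V W (f : V -> W) (fl : linear f) (c : R)
  (fc : forall x, nrm (f x) <= c * nrm x) x : bounded_of fl fc x = f x.
Proof. by []. Qed.

Lemma bounded_nrm V W (f : {bounded V -> W}) :
  exists2 c, 0 <= c & forall x, nrm (f x) <= c * nrm x.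
Proof.
have [c fc] := continuous_linear_nrm (@cts_fun _ _ f).
exists `|c| => // x; apply: le_trans (fc x) _.
by rewrite ler_wpM2r ?nrm_ge0 ?ler_norm.
Qed.

Let ball_image V W (f : {bounded V -> W}) :=
  [set complex.Re `|f x| | x in [set x : V | `|x| <= 1]].

Let ball_image_has_sup V W (f : {bounded V -> W}) : has_sup (ball_image f).
Proof.
split; first by exists (complex.Re `|f 0|), 0 => //=; rewrite normr0 ler01.
have [c c0 fc] := bounded_nrm f; exists c => _ [x /= x1 <-].
apply: le_trans (fc x) _; rewrite ler_piMr//.
by move: x1; rewrite normE lecR.
Qed.

Lemma opnorm_ge0 V W (f : {bounded V -> W}) : 0 <= opnorm f.
Proof.
apply: le_trans (nrm_ge0 (f 0)) _.
apply: (sup_upper_bound (ball_image_has_sup f)).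
by exists 0 => //=; rewrite normr0 ler01.
Qed.

Lemma nrm_opnorm V W (f : {bounded V -> W}) x : nrm (f x) <= opnorm f * nrm x.
Proof.
have [x0|x0] := eqVneq (nrm x) 0.
  by rewrite (nrm_eq0 x0) linear0 !nrm0 mulr0.
have x_gt0 : 0 < nrm x by rewrite lt_def x0 nrm_ge0.
suff : nrm (f ((nrm x)^-1%:C *: x)) <= opnorm f.
  rewrite linearZ/= nrmZ ger0_norm ?invr_ge0 ?nrm_ge0// mulrC.
  by rewrite ler_pdivrMr.
apply: (sup_upper_bound (ball_image_has_sup f)).
exists ((nrm x)^-1%:C *: x) => //=.
by rewrite normE nrmZ ger0_norm ?invr_ge0 ?nrm_ge0// mulVf.
Qed.

Lemma opnorm_le V W (f : {bounded V -> W}) (c : R) : 0 <= c ->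
  (forall x, nrm (f x) <= c * nrm x) -> opnorm f <= c.
Proof.
move=> c0 fc; apply: ge_sup; first exact: (ball_image_has_sup f).1.
move=> _ [x /= x1 <-]; apply: le_trans (fc x) _; rewrite ler_piMr//.
by move: x1; rewrite normE lecR.
Qed.

(* A minimizing sequence of [|x|^2 - 2 phi x] is Cauchy by the parallelogram
   identity; [phi] is only required to be linear over the reals. *)
Lemma riesz V (phi : V -> R) (c : R) : 0 <= c ->
  (forall x y, phi (x + y) = phi x + phi y) ->
  (forall (a : R) x, phi (a%:C *: x) = a * phi x) ->
  (forall x, phi x <= c * nrm x) ->
  exists z, forall x, phi x = rip x z.
Proof.
move=> c0 phiD phiZ phic.
pose q x := nrm x ^+ 2 - 2 * phi x.
have q_lb x : - c ^+ 2 <= q x.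
  by have := phic x; have := sqr_ge0 (nrm x - c); rewrite /q; lra.
pose m := inf (range q).
have q_inf : has_inf (range q).
  by split; [exists (q 0), 0|exists (- c ^+ 2) => _ [x _ <-]].
have mq x : m <= q x by apply: inf_lbound; [exact: q_inf.2|exists x].
have /choice[u uq] (n : nat) : exists x, q x < m + n.+1%:R^-1.
  have n0 : 0 < n.+1%:R^-1 :> R by rewrite invr_gt0.
  by have [_ [x _ <-] qx] := inf_adherent n0 q_inf; exists x.
have qD x t y : q (x + t%:C *: y) =
    q x + 2 * t * (rip x y - phi y) + t ^+ 2 * nrm y ^+ 2.
  rewrite /q nrmDsqr ripZr nrmZ phiD phiZ exprMn real_normK ?num_real//; ring.
have par x y : nrm (x - y) ^+ 2 <= 2 * (q x - m) + 2 * (q y - m).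
  (* The competitor for the infimum is the midpoint of [x] and [y]. *)
  have := mq (x + (- 2^-1)%:C *: (x - y)); rewrite qD.
  have -> : phi (x - y) = phi x - phi y.
    rewrite phiD -[- y in LHS]scaleN1r (_ : -1 = (-1)%:C :> R[i]); last first.
      by rewrite rmorphN1.
    by rewrite phiZ mulN1r.
  rewrite ripDr ripNr ripxx /q nrmDsqr ripNr nrmN; lra.
have [z uz] : exists z, (fun n => nrm (u n - z)) @ \oo --> 0.
  apply: nrm_cauchy_cvg => e e0.
  (* [par] counts each of the two gaps above [m] twice, which adds up to [e^2]. *)
  have e4 : 0 < e ^+ 2 / 4 by rewrite divr_gt0// exprn_gt0.
  have /cvgr0Pnorm_lt/(_ _ e4)[N _ Ne] := @cvg_harmonic R.
  exists N => i j Ni Nj.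
  rewrite -(@ltr_pXn2r _ 2) ?nnegrE ?nrm_ge0 ?(ltW e0)//.
  apply: le_lt_trans (par _ _) _.
  have hN k : (N <= k)%N -> k.+1%:R^-1 < e ^+ 2 / 4.
    by move=> /Ne; rewrite /= ger0_norm.
  have aux (a b s t E k : R) :
    a < E / 4 -> b < E / 4 -> s < k + a -> t < k + b ->
    2 * (s - k) + 2 * (t - k) < E by move=> *; lra.
  exact: (aux _ _ _ _ _ _ (hN _ Ni) (hN _ Nj) (uq i) (uq j)).
exists z => x.
(* This is the limit of [m <= q (u n + t x)], where [q (u n)] is within [1/(n+1)] of [m]. Only the
   term [rip (u n) x] has to converge. *)
have ge0 (t : R) : 0 <= 2 * t * (rip z x - phi x) + t ^+ 2 * nrm x ^+ 2.
  have cv : (fun n => 2 * t * (rip (u n) x - phi x) + t ^+ 2 * nrm x ^+ 2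
      + n.+1%:R^-1) @ \oo -->
      2 * t * (rip z x - phi x) + t ^+ 2 * nrm x ^+ 2 + 0.
    apply: cvgD; last exact: cvg_harmonic.
    apply: cvgD; last exact: cvg_cst.
    apply: cvgM; first exact: cvg_cst.
    apply: cvgB; last exact: cvg_cst.
    apply/cvgrPdist_le => e e0.
    have e1 : 0 < e / (nrm x + 1).
      by rewrite divr_gt0// ltr_wpDl// nrm_ge0.
    move/cvgr0Pnorm_lt : uz => /(_ _ e1); apply: filterS => n.
    rewrite ger0_norm ?nrm_ge0// ltr_pdivlMr ?ltr_wpDl ?nrm_ge0// => un.
    rewrite -ripNl -ripDl; apply: le_trans (ler_rip _ _) _.
    by rewrite nrmB; have := nrm_ge0 (u n - z); lra.
  rewrite -[leRHS]addr0; apply: (cvgr_to_ge cv); apply: nearW => n.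
  have aux (a b s w k : R) :
    s < k + a -> k <= s + b + w -> 0 <= b + w + a by move=> *; lra.
  by apply: (aux _ _ _ _ _ (uq n)); rewrite -qD.
rewrite ripC; apply/eqP; rewrite -subr_eq0 -sqrf_eq0 -opprB sqrrN.
set d := rip z x - phi x in ge0 *; set s := nrm x ^+ 2 in ge0.
have s0 : 0 <= s by exact: sqr_ge0.
have s1 : 0 < s + 1 by rewrite ltr_wpDl.
(* The denominator [s + 1] avoids the case [s = 0] and still makes the expression a negative
   multiple of [d^2]. *)
have := ge0 (- d / (s + 1)).
rewrite (_ : _ + _ = - (d ^+ 2 * (s + 2) / (s + 1) ^+ 2)); last first.
  by field; rewrite lt0r_neq0.
rewrite oppr_ge0 pmulr_lle0 ?invr_gt0 ?exprn_gt0//.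
rewrite pmulr_lle0 ?ltr_wpDl// => d0.
by rewrite eq_le d0 sqr_ge0.
Qed.

Lemma rip_scaler V (a : R[i]) (x y : V) : rip x (a *: y) = rip (a^*%C *: x) y.
Proof. by rewrite /rip innerZr innerZl. Qed.

(** Riesz representation of the real functional [x |-> Re <f x, y>] gives the value at [y];
    uniqueness of the representing vector gives linearity over [R[i]]. *)
Lemma adjoint_exists V W (f : {bounded V -> W}) :
  exists g : {bounded W -> V}, is_adjoint f g.
Proof.
have [c c0 fc] := bounded_nrm f.
have /choice[g fg] (y : W) : exists z, forall x, rip (f x) y = rip x z.
  apply: (@riesz _ _ (c * nrm y)); first by rewrite mulr_ge0// nrm_ge0.
  - by move=> x x'; rewrite linearD ripDl.
  - by move=> a x; rewrite linearZ/= ripZl.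
  - move=> x; apply: le_trans (ler_norm _) _; apply: le_trans (ler_rip _ _) _.
    by rewrite mulrAC ler_wpM2r ?nrm_ge0.
have gl : linear g.
  move=> a y y'; apply: rip_ext => x; rewrite ripC -fg.
  rewrite ripDr rip_scaler -linearZ/= !fg -rip_scaler -ripDr.
  exact: ripC.
have gc y : nrm (g y) <= c * nrm y.
  have [->|gy0] := eqVneq (nrm (g y)) 0; first by rewrite mulr_ge0// nrm_ge0.
  rewrite -(@ler_pM2r _ (nrm (g y))); last by rewrite lt_def gy0 nrm_ge0.
  rewrite -expr2 -ripxx -fg; apply: le_trans (ler_norm _) _.
  by apply: le_trans (ler_rip _ _) _; rewrite mulrAC ler_wpM2r ?nrm_ge0.
(* The imaginary parts agree as well, being real parts with ['i *: y] in place of [y], since [g]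
   commutes with ['i]. *)
exists (bounded_of gl gc) => x y; rewrite !innerE bounded_ofE !fg.
by rewrite -[in RHS](scalable_linear gl).
Qed.

Lemma adjointP V W (f : {bounded V -> W}) : is_adjoint f (adjoint f).
Proof.
rewrite /adjoint; case: pselect => [ex|[]]; last exact: adjoint_exists.
by case: cid.
Qed.

Lemma rip_adjoint V W (f : {bounded V -> W}) x y :
  rip (f x) y = rip x (adjoint f y).
Proof. by rewrite /rip adjointP. Qed.

Lemma rip_adjointl V W (f : {bounded V -> W}) x y :
  rip (adjoint f x) y = rip x (f y).
Proof. by rewrite ripC -rip_adjoint ripC. Qed.

Lemma nrm_adjoint V W (f : {bounded V -> W}) (c : R) : 0 <= c ->
  (forall x, nrm (f x) <= c * nrm x) ->
  forall y, nrm (adjoint f y) <= c * nrm y.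
Proof.
move=> c0 fc y; apply: nrm_le_rip => [|x]; first by rewrite mulr_ge0// nrm_ge0.
rewrite rip_adjointl; apply: le_trans (ler_norm _) _.
apply: le_trans (ler_rip _ _) _.
by rewrite [leRHS]mulrAC mulrC ler_wpM2r ?nrm_ge0.
Qed.

Lemma adjoint_uniq V W (f : {bounded V -> W}) (g : W -> V) :
  (forall x y, rip (f x) y = rip x (g y)) -> forall y, adjoint f y = g y.
Proof.
by move=> fg y; apply: rip_ext => x; rewrite rip_adjointl ripC fg ripC.
Qed.

End bounded_operators.

(** * The defect operator of a contraction *)

Section defect.
Context {R : realType} {V : hilbertType R}.
Implicit Types S : V -> V.

(** These are the symmetric maps with [0 <= S <= 1], kept as plain functions so that they can be
    iterated without rebuilding structures. *)
Definition effect S := [/\ linear S, forall x y, rip (S x) y = rip x (S y),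
  forall x, 0 <= rip (S x) x & forall x, rip (S x) x <= rip x x].

Let next S x := S x - S (S x).

(* [S - S^2 = S (1 - S) S + (1 - S) S (1 - S)] *)
Let effect_next S : effect S -> effect (next S).
Proof.
move=> [Sl Ss S0 S1]; rewrite /next.
have SB x y : S (x - y) = S x - S y.
  by rewrite addrC -scaleN1r Sl scaleN1r addrC.
have next0 x : 0 <= rip (S x) x - rip (S x) (S x).
  have := S1 (S x); have := S0 (x - S x).
  rewrite SB !(ripDl, ripDr, ripNl, ripNr) -(Ss (S x) x).
  by have := Ss (S x) x; lra.
split.
- by move=> a x y; rewrite !Sl opprD addrACA scalerBr.
- by move=> x y; rewrite ripDl ripDr ripNl ripNr !Ss.
- by move=> x; rewrite ripDl ripNl (Ss (S x)).
- move=> x; rewrite ripDl ripNl (Ss (S x)); apply: le_trans (S1 x).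
  by rewrite gerBl ripxx sqr_ge0.
Qed.

Variables (W : hilbertType R) (T : {bounded V -> W}).
Hypothesis T_contraction : forall x, nrm (T x) <= nrm x.

Let S k : V -> V := iter k next (fun x => x - adjoint T (T x)).

Let S_effect k : effect (S k).
Proof.
elim: k => [|k IH]; last exact: effect_next.
have S0E x y : rip (x - adjoint T (T x)) y = rip x y - rip (T x) (T y).
  by rewrite ripDl ripNl rip_adjointl.
split.
- move=> a x y /=; rewrite (linearP T) (linearP (adjoint T)).
  by rewrite opprD addrACA scalerBr.
- by move=> x y; rewrite S0E [RHS]ripC S0E ripC (ripC (T x)).
- move=> x; rewrite S0E subr_ge0 !ripxx ler_pXn2r ?nnegrE ?nrm_ge0//.
- by move=> x; rewrite S0E gerBl ripxx sqr_ge0.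
Qed.

Let S_sqseries x N :
  sqseries (fun k => S k x) N = rip (S 0 x) x - rip (S N x) x.
Proof.
rewrite /sqseries /series/=; elim: N => [|N IH]; first by rewrite big_nil subrr.
rewrite big_nat_recr// IH /= -/(S N) -ripxx.
have [_ Ss _ _] := S_effect N.
by rewrite /next (ripDl (S N x)) (ripNl (S N (S N x))) (Ss (S N x)); ring.
Qed.

Let S_l2 x : exists M, forall N, sqseries (fun k => S k x) N <= M.
Proof.
exists (rip (S 0 x) x) => N; rewrite S_sqseries gerBl.
by have [_ _ + _] := S_effect N; exact.
Qed.

Let defect x : l2 (fun=> V) := L2 (S_l2 x).

Let nrm_defect x : nrm (defect x) ^+ 2 = nrm x ^+ 2 - nrm (T x) ^+ 2.
Proof.
(* The squares [|S_N x|^2] are the terms of a convergent series, so by Cauchy-Schwarz the remainder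
   [<S_N x, x>] of the telescoped sum vanishes in the limit. *)
have Sx0 : (fun N => nrm (S N x)) @ \oo --> 0.
  have := cvg_series_cvg_0 (@is_cvg_sqseries R (fun=> V) (defect x)).
  have /(@continuous_cvg _ _ _ _ _ _ Num.sqrt) := @sqrt_continuous R (0 : R).
  move=> /[apply]; rewrite sqrtr0; apply: cvg_trans.
  apply: near_eq_cvg; apply: nearW => N.
  by rewrite /= sqrtr_sqr ger0_norm ?nrm_ge0.
have Sxx0 : (fun N => rip (S N x) x) @ \oo --> 0.
  apply: (@squeeze_cvgr _ _ _ _ (fun=> 0) (fun N => nrm (S N x) * nrm x)).
  - apply: nearW => N; have [_ _ -> _]/= := S_effect N.
    exact: le_trans (ler_norm _) (ler_rip _ _).
  - exact: cvg_cst.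
  - by rewrite -(mul0r (nrm x)); apply: cvgM => //; exact: cvg_cst.
rewrite l2_nrm2 lip_sq -!ripxx -(rip_adjointl T) -[RHS]subr0.
rewrite (_ : rip x x - rip (adjoint T (T x)) x = rip (S 0 x) x); last first.
  by rewrite ripDl ripNl.
apply/cvg_lim => //.
rewrite (_ : sqseries _ = fun N => rip (S 0 x) x - rip (S N x) x).
  by apply: cvgB => //; exact: cvg_cst.
by apply/funext => N; exact: S_sqseries.
Qed.

(* The defect [1 - T^* T] is factored without a square root: with
   [S_0 = 1 - T^* T] and [S_(k+1) = S_k - S_k^2], the sum of the [S_k^2]
   telescopes to [S_0]. *)
Lemma defect_operator : exists D : {bounded V -> l2 (fun=> V)},
  forall x, nrm (D x) ^+ 2 = nrm x ^+ 2 - nrm (T x) ^+ 2.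
Proof.
have Dl : linear defect.
  move=> a x y; apply: l2_ext => k; rewrite l2DE l2ZE /=.
  by have [+ _ _ _] := S_effect k; exact.
have D1 x : nrm (defect x) <= 1 * nrm x.
  rewrite mul1r -(@ler_pXn2r _ 2) ?nnegrE ?nrm_ge0// nrm_defect.
  by rewrite gerBl sqr_ge0.
by exists (bounded_of Dl D1).
Qed.

End defect.

(** * Symmetry of resolvents at real points *)

Lemma resolvent_sym (R : realType) (V : hilbertType R) (A : operator V)
    (z : R[i]) :
  self_adjoint A -> resolvent_set A z -> z \is Num.real ->
  forall x, adjoint (resolvent A z) x = resolvent A z x.
Proof.
move=> [_ A_sa] zA /complex_realP[a za]; apply: adjoint_uniq => x y.
have [SA AS] : is_resolvent A z (resolvent A z).
  by rewrite /resolvent; case: pselect => // ex; case: cid.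
move: (resolvent A z) SA AS => S SA _.
have [Sx Ax] := SA x; have [Sy Ay] := SA y.
(* Self-adjointness enters as the symmetry of [A] on the vectors [S x] and [S y]. *)
have : adjoint_graph A (S y, A (S y)) by rewrite A_sa.
move=> /(_ _ Sx)/= /(congr1 (@complex.Re R)); rewrite -!/(rip _ _) => Axy.
(* Both free vectors are written as values of [A - z], whose shift is symmetric because [z] is
   real. *)
rewrite -[in LHS]Ay -[x in RHS]Ax za.
by rewrite ripDr ripNr ripZr ripDl ripNl ripZl Axy.
Qed.

(** * Estimates for a single quasi-unitary operator *)

Section estimates.
Context {R : realType} {V Z : hilbertType R}.
Variables (J : {bounded V -> Z}) (S : {bounded V -> V}) (T : {bounded Z -> Z}).
Variables (d r : R).
Hypotheses (d0 : 0 <= d) (r0 : 0 <= r).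
Hypothesis J_le : forall x, nrm (J x) <= (1 + d) * nrm x.
Hypothesis T_le : forall x, nrm (T x) <= r * nrm x.
Hypothesis JJS : forall x, nrm (S x - adjoint J (J (S x))) <= d * nrm x.
Hypothesis JJSa :
  forall x, nrm (adjoint S x - adjoint J (J (adjoint S x))) <= d * nrm x.
Hypothesis JJTa :
  forall x, nrm (adjoint T x - J (adjoint J (adjoint T x))) <= d * nrm x.
Hypothesis TJ : forall x, nrm (T (J x) - J (S x)) <= d * nrm x.

Let p := r + 2 * d.

Let d1 : 0 < 1 + d. Proof. by rewrite ltr_wpDr. Qed.
Let p0 : 0 <= p. Proof. by rewrite addr_ge0// mulr_ge0. Qed.

(** Up to errors of order [d], [S] is [J^* J S] and [J S] is [T J]; this bounds [S] by the norm of
    [T], so that the final constants involve only the limit resolvent. *)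
Lemma nrm_QUE_resolvent x : nrm (S x) <= (1 + d) ^+ 2 * p * nrm x.
Proof.
have Ja := nrm_adjoint (ltW d1) J_le (J (S x)).
have h1 := ler_nrmD (S x - adjoint J (J (S x))) (adjoint J (J (S x))).
rewrite subrK in h1.
have h2 := ler_nrmD (- (T (J x) - J (S x))) (T (J x)).
rewrite opprB subrK nrmB in h2.
have h3 : nrm (T (J x)) <= r * ((1 + d) * nrm x).
  by apply: le_trans (T_le _) _; rewrite ler_wpM2l.
have h4 : nrm (J (S x)) <= (d + r * (1 + d)) * nrm x by have := TJ x; lra.
have h5 : nrm (adjoint J (J (S x))) <= (1 + d) * ((d + r * (1 + d)) * nrm x).
  by apply: le_trans Ja _; rewrite ler_wpM2l// ltW.
apply: (@le_trans _ _ ((d + (1 + d) * (d + r * (1 + d))) * nrm x)).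
  by have := JJS x; lra.
rewrite ler_wpM2r ?nrm_ge0// /p -subr_ge0.
rewrite (_ : _ - _ = d ^+ 2 * (3 + 2 * d)); last by ring.
by rewrite mulr_ge0 ?sqr_ge0// addr_ge0// mulr_ge0.
Qed.

Let c := (1 + d)^-1.
(** A squared bound for the defect on the range of the resolvent. The first term comes from
    quasi-unitarity, the second from the rescaling, as [(1 + d)^2 - 1 = 2 d + d^2]. *)
Let b2 := d * p + (2 * d + d ^+ 2) * (1 + d) ^+ 2 * p ^+ 2.

Let Jc_linear : linear (fun x => c%:C *: J x).
Proof.
by move=> a x y /=; rewrite linearP scalerDr !scalerA [c%:C * a]mulrC.
Qed.

Let c0 : 0 < c. Proof. by rewrite invr_gt0. Qed.

Let Jc_le x : nrm (c%:C *: J x) <= 1 * nrm x.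
Proof.
rewrite nrmZ gtr0_norm// mul1r /c ler_pdivrMl//; exact: J_le.
Qed.

Let Jc : {bounded V -> Z} := bounded_of Jc_linear Jc_le.

Let Jc_adj x : adjoint Jc x = c%:C *: adjoint J x.
Proof.
apply: (@adjoint_uniq _ _ _ _ (fun x => c%:C *: adjoint J x)) => u v.
by rewrite bounded_ofE ripZl ripZr rip_adjoint.
Qed.

Lemma b2_ge0 : 0 <= b2.
Proof.
by rewrite /b2 addr_ge0 ?mulr_ge0 ?sqr_ge0 ?addr_ge0 ?mulr_ge0 ?sqr_ge0.
Qed.

(** The unscaled difference is [<(1 - J^* J) Q x, Q x>], of order [d]. The map [Q] is left open to
    cover both [S] and its adjoint. *)
Lemma defect_resolvent (Q : V -> V) (x : V) :
  nrm (Q x) <= (1 + d) ^+ 2 * p * nrm x ->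
  nrm (Q x - adjoint J (J (Q x))) <= d * nrm x ->
  nrm (Q x) ^+ 2 - nrm (Jc (Q x)) ^+ 2 <= b2 * nrm x ^+ 2.
Proof.
move=> Qx JQx.
rewrite bounded_ofE nrmZ gtr0_norm// exprMn.
have h : nrm (Q x) ^+ 2 - nrm (J (Q x)) ^+ 2 <= d * nrm x * nrm (Q x).
  have -> : nrm (Q x) ^+ 2 - nrm (J (Q x)) ^+ 2 =
      rip (Q x - adjoint J (J (Q x))) (Q x).
    by rewrite ripDl ripNl rip_adjointl !ripxx.
  apply: le_trans (ler_norm _) _; apply: le_trans (ler_rip _ _) _.
  by rewrite ler_wpM2r ?nrm_ge0.
have c1 : c ^+ 2 * (1 + d) ^+ 2 = 1.
  by rewrite -exprMn mulVf ?expr1n// gt_eqF.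
have -> : nrm (Q x) ^+ 2 - c ^+ 2 * nrm (J (Q x)) ^+ 2 =
    c ^+ 2 * ((2 * d + d ^+ 2) * nrm (Q x) ^+ 2 +
      (nrm (Q x) ^+ 2 - nrm (J (Q x)) ^+ 2)).
  rewrite -[X in X - _]mul1r -{1}c1; ring.
have -> : b2 * nrm x ^+ 2 = c ^+ 2 * ((2 * d + d ^+ 2) *
    ((1 + d) ^+ 2 * p * nrm x) ^+ 2 + d * nrm x * ((1 + d) ^+ 2 * p * nrm x)).
  transitivity (b2 * nrm x ^+ 2 * (c ^+ 2 * (1 + d) ^+ 2)).
    by rewrite c1 mulr1.
  rewrite /b2; ring.
rewrite ler_wpM2l ?sqr_ge0// lerD//.
  rewrite ler_wpM2l ?addr_ge0 ?mulr_ge0 ?sqr_ge0//.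
  by rewrite ler_pXn2r ?nnegrE ?nrm_ge0// (le_trans (nrm_ge0 _) Qx).
by apply: le_trans h _; rewrite ler_wpM2l// mulr_ge0// nrm_ge0.
Qed.

(** Without rescaling, [J S J^* - T = (J S - T J) J^* + T (J J^* - 1)], and both terms are of order
    [d]. *)
Lemma compression_resolvent x :
  nrm (Jc (S (adjoint Jc x)) - T x) <= 2 * d * (1 + r) * nrm x.
Proof.
rewrite Jc_adj bounded_ofE !linearZ/= scalerA.
set y := adjoint J x.
have hy : nrm y <= (1 + d) * nrm x by apply: nrm_adjoint => //; exact: ltW.
(* [T (J J^* - 1)] is the adjoint of [(J J^* - 1) T^*], which is why the estimate for [adjoint T] is
   the one that applies. *)
have h1 : nrm (T (J y - x)) <= d * nrm x.
  apply: nrm_le_rip => [|z]; first by rewrite mulr_ge0// nrm_ge0.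
  have -> : rip (T (J y - x)) z =
      rip x (- (adjoint T z - J (adjoint J (adjoint T z)))).
    rewrite rip_adjoint opprB ripDr ripNr ripDl ripNl rip_adjoint.
    by rewrite /y rip_adjointl.
  apply: le_trans (ler_norm _) _; apply: le_trans (ler_rip _ _) _.
  by rewrite nrmN [leRHS]mulrAC mulrC ler_wpM2r ?nrm_ge0.
have h2 : nrm (J (S y) - T (J y)) <= d * ((1 + d) * nrm x).
  by rewrite nrmB; apply: le_trans (TJ y) _; rewrite ler_wpM2l.
have c1 : c * c * (1 + d) ^+ 2 = 1.
  by rewrite -expr2 -exprMn mulVf ?expr1n// gt_eqF.
(* Since [c^2 (1 + d)^2 = 1], the rescaling costs [(2 d + d^2) T x] inside the common factor
   [c^2]. *)
have -> : (c%:C * c%:C) *: J (S y) - T x = (c * c)%:C *: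
    ((J (S y) - T (J y)) + (T (J y - x) - (2 * d + d ^+ 2)%:C *: T x)).
  rewrite linearB/= -[T x in LHS]scale1r.
  rewrite (_ : 1 = (c * c)%:C * (1 + (2 * d + d ^+ 2)%:C) :> R[i]); last first.
    rewrite (_ : 1 + _ = (1 + (2 * d + d ^+ 2))%:C); last first.
      by rewrite [RHS]rmorphD.
    by rewrite -rmorphM/= (_ : _ * (1 + _) = 1)// -[RHS]c1; ring.
  rewrite rmorphM/= -(scalerA (c%:C * c%:C)) -scalerBr; congr (_ *: _).
  by rewrite scalerDl scale1r opprD !addrA subrK.
rewrite nrmZ ger0_norm ?mulr_ge0 ?(ltW c0)//.
have e0 : 0 <= 2 * d + d ^+ 2 by rewrite addr_ge0 ?mulr_ge0 ?sqr_ge0.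
have h3 : nrm (- ((2 * d + d ^+ 2)%:C *: T x)) <=
    (2 * d + d ^+ 2) * (r * nrm x).
  by rewrite nrmN nrmZ ger0_norm// ler_wpM2l.
have h4 : nrm ((J (S y) - T (J y)) + (T (J y - x) - (2 * d + d ^+ 2)%:C *: T x))
    <= (2 * d + d ^+ 2) * (1 + r) * nrm x.
  apply: le_trans (ler_nrmD _ _) _.
  have := ler_nrmD (T (J y - x)) (- ((2 * d + d ^+ 2)%:C *: T x)); lra.
apply: le_trans (ler_wpM2l _ h4) _; first by rewrite mulr_ge0 ?(ltW c0).
have -> : 2 * d * (1 + r) * nrm x =
    c * c * ((1 + d) ^+ 2 * (2 * d) * (1 + r) * nrm x).
  by rewrite -[LHS]mul1r -{1}c1; ring.
rewrite ler_wpM2l ?mulr_ge0 ?(ltW c0)// ler_wpM2r ?nrm_ge0//.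
rewrite ler_wpM2r ?addr_ge0// -subr_ge0.
rewrite (_ : _ - _ = d ^+ 2 * (3 + 2 * d)); last by ring.
by rewrite mulr_ge0 ?sqr_ge0// addr_ge0// mulr_ge0.
Qed.

Lemma QUE_dilation :
  exists (P : {bounded V -> Z}) (W : {bounded V -> l2 (fun=> V)}),
  [/\ forall x, nrm (P x) ^+ 2 + nrm (W x) ^+ 2 = nrm x ^+ 2,
    forall x, nrm (P (S (adjoint P x)) - T x) <= 2 * d * (1 + r) * nrm x,
    forall x, nrm (W (S x)) ^+ 2 <= b2 * nrm x ^+ 2 &
    forall x, nrm (W (adjoint S x)) ^+ 2 <= b2 * nrm x ^+ 2].
Proof.
have Jc1 x : nrm (Jc x) <= nrm x by have := Jc_le x; rewrite mul1r.
have [W WE] := defect_operator Jc1.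
exists Jc, W; split.
- by move=> x; rewrite WE addrC subrK.
- exact: compression_resolvent.
- move=> x; rewrite WE.
  by apply: defect_resolvent => //; exact: nrm_QUE_resolvent.
- move=> x; rewrite WE; apply: (@defect_resolvent (adjoint S)) => //.
  apply: nrm_adjoint; last exact: nrm_QUE_resolvent.
  by rewrite mulr_ge0// sqr_ge0.
Qed.

End estimates.

Lemma opnormP (R : realType) (V W : hilbertType R) (f : {bounded V -> W})
    (c : R) :
  opnorm f <= c -> forall x, nrm (f x) <= c * nrm x.
Proof.
move=> fc x; apply: le_trans (nrm_opnorm f x) _.
by rewrite ler_wpM2r ?nrm_ge0.
Qed.

(** * Orthogonality of two coordinates of the l2 sum *)

Section l2_coordinates.
Context {R : realType} (E : nat -> hilbertType R).

Lemma rip_l2_inj n (x : E n) (f : l2 E) : rip (l2_inj x) f = rip x (f n).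
Proof. by rewrite l2_rip lip_inj. Qed.

Lemma nrm_l2_injD m n (x : E m) (y : E n) : m != n ->
  nrm (l2_inj x + l2_inj y) ^+ 2 = nrm x ^+ 2 + nrm y ^+ 2.
Proof.
move=> mn; rewrite nrmDsqr rip_l2_inj l2_inj_neq// ripC (realip0l rip_real).
by rewrite mulr0 addr0 !nrm_l2_inj.
Qed.

(** Bessel's inequality: the squared norm of [f] minus its two coordinate vectors is nonnegative. *)
Lemma nrm_coord2 m n (f : l2 E) : m != n ->
  nrm (f m) ^+ 2 + nrm (f n) ^+ 2 <= nrm f ^+ 2.
Proof.
move=> mn; have := sqr_ge0 (nrm (f - (l2_inj (f m) + l2_inj (f n)))).
rewrite nrmDsqr nrmN nrm_l2_injD// ripNr ripDr ![rip f _]ripC.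
rewrite !rip_l2_inj !ripxx.
by lra.
Qed.

End l2_coordinates.

(** * The common parent space *)

Section sum_space.
Context {R : realType} (H : nat -> hilbertType R) (Hoo : hilbertType R).

(** Index 0 is reserved for the limit space, so the auxiliary space of the [n]-th operator sits at
    [n.+1]. One parent space and one embedding of [Hoo] serve all [n]. *)
Definition summand k : hilbertType R :=
  if k is n.+1 then (l2 (fun=> H n) : hilbertType R) else Hoo.

Definition sum_space : hilbertType R := l2 summand.

Let inj0 (x : Hoo) : sum_space := @l2_inj R summand 0 x.
Let injS n (x : l2 (fun=> H n)) : sum_space := @l2_inj R summand n.+1 x.

Let inj0_linear : linear inj0.
Proof. by move=> a x y; exact: (@l2_injP R summand 0). Qed.

Let nrm_inj0 x : nrm (inj0 x) <= 1 * nrm x.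
Proof. by rewrite mul1r nrm_l2_inj. Qed.

Definition iota_oo : {bounded Hoo -> sum_space} :=
  bounded_of inj0_linear nrm_inj0.

Lemma iota_oo_isometry : is_isometry iota_oo.
Proof. by move=> x; rewrite !normE bounded_ofE nrm_l2_inj. Qed.

Lemma adjoint_iota_oo (k : sum_space) : adjoint iota_oo k = k 0.
Proof.
apply: (@adjoint_uniq _ _ _ _ (fun k : sum_space => k 0 : Hoo)) => x y.
by rewrite bounded_ofE rip_l2_inj.
Qed.

Variable n : nat.
Variables (P : {bounded H n -> Hoo}) (W : {bounded H n -> l2 (fun=> H n)}).
Hypothesis PW : forall x, nrm (P x) ^+ 2 + nrm (W x) ^+ 2 = nrm x ^+ 2.

Let f x := inj0 (P x) + @injS n (W x).

Let f_linear : linear f.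
Proof.
move=> a x y; rewrite /f !linearP inj0_linear.
rewrite (_ : injS (a *: W x + W y) = a *: injS (W x) + injS (W y)).
  by rewrite scalerDr addrACA.
exact: (@l2_injP R summand n.+1).
Qed.

Let nrm_f x : nrm (f x) = nrm x.
Proof.
apply/eqP; rewrite -(@eqrXn2 _ 2) ?nrm_ge0//.
by rewrite nrm_l2_injD// PW.
Qed.

Let nrm_f_le x : nrm (f x) <= 1 * nrm x. Proof. by rewrite nrm_f mul1r. Qed.

Definition iota_dilation : {bounded H n -> sum_space} :=
  bounded_of f_linear nrm_f_le.

Lemma iota_dilation_isometry : is_isometry iota_dilation.
Proof. by move=> x; rewrite !normE nrm_f. Qed.

Lemma adjoint_iota_dilation (k : sum_space) :
  adjoint iota_dilation k = adjoint P (k 0) + adjoint W (k n.+1).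
Proof.
apply: (@adjoint_uniq _ _ _ _
  (fun k : sum_space => adjoint P (k 0) + adjoint W (k n.+1))) => x y.
by rewrite bounded_ofE ripDl ripDr !rip_l2_inj !rip_adjoint.
Qed.

Variables (S : {bounded H n -> H n}) (T : {bounded Hoo -> Hoo}) (a b2 : R).
Hypotheses (a0 : 0 <= a) (b20 : 0 <= b2).
Hypothesis PST : forall x, nrm (P (S (adjoint P x)) - T x) <= a * nrm x.
Hypothesis WS : forall x, nrm (W (S x)) ^+ 2 <= b2 * nrm x ^+ 2.
Hypothesis WSa : forall x, nrm (W (adjoint S x)) ^+ 2 <= b2 * nrm x ^+ 2.

(** Only the coordinates [u] and [v] of [k] at 0 and [n.+1] matter. The image of [u] has two
    orthogonal parts, with squared bounds [a^2] and [b2]; that of [v] has norm at most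
    [sqrt b2 |v|]. Cauchy-Schwarz in the plane adds the squared constants. *)
Lemma dilation_estimate (c : R) : 0 <= c -> a ^+ 2 + 2 * b2 <= c ^+ 2 ->
  opnorm ((iota_dilation \o S \o adjoint iota_dilation) \-
          (iota_oo \o T \o adjoint iota_oo)) <= c.
Proof.
move=> c0 abc; apply: opnorm_le => // k /=.
rewrite adjoint_iota_dilation adjoint_iota_oo.
set u : Hoo := k 0; set v : l2 (fun=> H n) := k n.+1.
have b2E := sqr_sqrtr b20; have b0 := sqrtr_ge0 b2.
set b := Num.sqrt b2 in b2E b0.
(* [S W^*] is the adjoint of [W S^*] and inherits its bound. *)
have SWv : nrm (S (adjoint W v)) <= b * nrm v.
  apply: nrm_le_rip => [|y]; first by rewrite mulr_ge0// nrm_ge0.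
  rewrite rip_adjoint rip_adjointl; apply: le_trans (ler_norm _) _.
  apply: le_trans (ler_rip _ _) _; rewrite mulrAC mulrC ler_wpM2r ?nrm_ge0//.
  by rewrite -(@ler_pXn2r _ 2) ?nnegrE ?mulr_ge0 ?nrm_ge0// exprMn b2E.
have Pu : nrm (adjoint P u) <= nrm u.
  rewrite -[leRHS]mul1r; apply: nrm_adjoint => // x.
  rewrite mul1r -(@ler_pXn2r _ 2) ?nnegrE ?nrm_ge0// -PW.
  by rewrite lerDl sqr_ge0.
have -> : iota_dilation (S (adjoint P u + adjoint W v)) - iota_oo (T u) =
    (inj0 (P (S (adjoint P u)) - T u) + @injS n (W (S (adjoint P u)))) +
    iota_dilation (S (adjoint W v)).
  rewrite linearD [X in X - _ = _]linearD addrAC; congr (_ + _).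
  rewrite /= /f addrAC; congr (_ + _).
  by rewrite [inj0 (P _)](_ : _ = iota_oo (P (S (adjoint P u))))// -linearB.
set w1 := inj0 _ + _; set w2 := iota_dilation _.
have w1E : nrm w1 ^+ 2 <= (a ^+ 2 + b2) * nrm u ^+ 2.
  rewrite nrm_l2_injD// mulrDl lerD//.
    by rewrite -exprMn ler_pXn2r ?nnegrE ?mulr_ge0 ?nrm_ge0.
  apply: le_trans (WS _) _; rewrite ler_wpM2l//.
  by rewrite ler_pXn2r ?nnegrE ?nrm_ge0.
have w2E : nrm w2 <= b * nrm v by rewrite nrm_f.
have ab0 : 0 <= a ^+ 2 + b2 by rewrite addr_ge0 ?sqr_ge0.
have s2 := sqr_sqrtr ab0; have s0 := sqrtr_ge0 (a ^+ 2 + b2).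
set s := Num.sqrt _ in s2 s0.
have w1E' : nrm w1 <= s * nrm u.
  by rewrite -(@ler_pXn2r _ 2) ?nnegrE ?mulr_ge0 ?nrm_ge0// exprMn s2.
have uv : nrm u ^+ 2 + nrm v ^+ 2 <= nrm k ^+ 2.
  exact: (nrm_coord2 k (isT : 0%N != n.+1)).
rewrite -(@ler_pXn2r _ 2) ?nnegrE ?mulr_ge0 ?nrm_ge0// exprMn.
apply: (@le_trans _ _ ((s * nrm u + b * nrm v) ^+ 2)).
  rewrite ler_pXn2r ?nnegrE ?addr_ge0 ?mulr_ge0 ?nrm_ge0//.
  by apply: le_trans (ler_nrmD _ _) _; exact: lerD.
apply: (@le_trans _ _ ((s ^+ 2 + b ^+ 2) * (nrm u ^+ 2 + nrm v ^+ 2))).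
  by have := sqr_ge0 (s * nrm v - b * nrm u); lra.
rewrite s2 b2E ler_pM ?addr_ge0 ?sqr_ge0//.
by move: abc; lra.
Qed.

End sum_space.

(** * Comparison of the constants *)

Lemma dilation_bound (R : realType) (r d : R) : 0 <= r -> 0 <= d ->
  let p := r + 2 * d in
  let t := Num.sqrt d * (2 * Num.sqrt p + Num.sqrt d) in
  let a := 2 * d * (1 + r) in
  let b2 := d * p + (2 * d + d ^+ 2) * (1 + d) ^+ 2 * p ^+ 2 in
  0 <= t /\ a ^+ 2 + 2 * b2 <= (t * (1 + (r + 2 * t) * (2 + 3 * t))) ^+ 2.
Proof.
move=> r0 d0 p t a b2.
have p0 : 0 <= p by rewrite /p; lra.
have := sqr_sqrtr d0; have := sqr_sqrtr p0.
have := sqrtr_ge0 d; have := sqrtr_ge0 p.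
rewrite /t; move: (Num.sqrt d) (Num.sqrt p) => s w w0 s0 wp sd.
rewrite -/t.
have sw : s * s * 5 <= s * w * 4.
  suff : 5 * s <= 4 * w by move=> /(ler_wpM2l s0); lra.
  rewrite -(@ler_pXn2r _ 2) ?nnegrE ?mulr_ge0// !exprMn sd wp /p.
  by have := mulr_ge0 r0 d0; lra.
pose t' : R := s * (2 * w + s).
have t'E : t' ^+ 2 = 4 * d * p + 4 * (s * w) * d + d ^+ 2.
  by rewrite /t' -wp -sd; ring.
have sw0 : 0 <= s * w by exact: mulr_ge0.
have td : 7 / 2 * d <= t' by rewrite /t' -sd; lra.
have t'0 : 0 <= t' by rewrite mulr_ge0// addr_ge0// mulr_ge0.
have tdp : 4 * d * p <= t' ^+ 2.
  by rewrite t'E -addrA lerDl addr_ge0 ?sqr_ge0// !mulr_ge0.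
split=> //; rewrite -/t'.
(* A polynomial lower bound for the last factor, from [2 t >= 7 d] and [3 t >= 21/2 d], the latter
   rounded down to [10 d]. *)
pose Q := 1 + (r + 7 * d) * (2 + 10 * d).
have Q0 : 0 <= Q by rewrite /Q addr_ge0// mulr_ge0// addr_ge0// mulr_ge0.
have QB : Q <= 1 + (r + 2 * t') * (2 + 3 * t').
  by rewrite lerD2l ler_pM//; lra.
(* One factor [2 d] of [a^2] is replaced by [p], so that [2 d p] can be factored out of the whole
   difference. *)
have a2 : a ^+ 2 <= 2 * d * p * (1 + r) ^+ 2.
  rewrite /a exprMn ler_wpM2r ?sqr_ge0// expr2 ler_wpM2l ?mulr_ge0//.
  by rewrite /p lerDr.
apply: (@le_trans _ _ (4 * d * p * Q ^+ 2)); last first.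
  rewrite exprMn ler_pM ?sqr_ge0 ?mulr_ge0//.
  by rewrite ler_pXn2r ?nnegrE// (le_trans Q0).
apply: le_trans (lerD a2 (lexx _)) _.
rewrite -subr_ge0.
have -> : 4 * d * p * Q ^+ 2 - (2 * d * p * (1 + r) ^+ 2 + 2 * b2) =
  2 * d * p * (2 * Q ^+ 2 - (1 + r) ^+ 2 - 1 - p * (2 + d) * (1 + d) ^+ 2).
  by rewrite /b2; ring.
apply: mulr_ge0; first by rewrite !mulr_ge0.
rewrite /Q /p.
(* The remaining polynomial in [r] and [d] has nonnegative coefficients and no constant term; its
   monomials of degree at least 2 are handed to [lra]. *)
have m k l : 0 <= r ^+ k * d ^+ l by rewrite mulr_ge0 ?exprn_ge0.
have := m 1%N 1%N; have := m 0%N 2%N; have := m 2%N 0%N; 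
have := m 2%N 1%N; have := m 1%N 2%N; have := m 2%N 2%N; 
have := m 1%N 3%N; have := m 0%N 3%N; have := m 0%N 4%N; 
lra.
Qed.

(** * Assembly of the dilations into Weidmann convergence, with rates *)

Theorem theorem3p20 (R : realType) (H : nat -> hilbertType R)
    (Hoo : hilbertType R) (A : forall n, operator (H n)) (Aoo : operator Hoo)
    (z0 : R[i]) (delta : nat -> R)
    (A_sa : forall n, self_adjoint (A n)) (Aoo_sa : self_adjoint Aoo)
    (A_QUE : QUE_converges A Aoo z0 delta) :
  let r := opnorm (resolvent Aoo z0) in
  let tdelta n := Num.sqrt (delta n) *
    (2 * Num.sqrt (r + 2 * delta n) + Num.sqrt (delta n)) in
  let bound n := tdelta n * (1 + (r + 2 * tdelta n) * (2 + 3 * tdelta n)) in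
  [/\ exists hdelta : nat -> R, Weidmann_converges A Aoo z0 hdelta /\
        forall n, hdelta n <= bound n,
      bound =O_\oo (fun n => Num.sqrt (delta n)) &
      tdelta =O_\oo (fun n => Num.sqrt (delta n))].
Proof.
move=> r tdelta bound.
have [[d0 dcvg] [An Aoor] [J JQ]] := A_QUE.
have r0 : 0 <= r by exact: opnorm_ge0.
have t0 n : 0 <= tdelta n by have [] := dilation_bound r0 (d0 n).
have bound0 n : 0 <= bound n.
  by rewrite mulr_ge0// addr_ge0// mulr_ge0// addr_ge0// mulr_ge0.
(* The second factor of [tdelta n] evaluated at [delta n = 1], an upper bound for it once
   [delta n < 1]. *)
pose C := 2 * Num.sqrt (r + 2) + 1.
have C0 : 0 <= C by rewrite addr_ge0// mulr_ge0// sqrtr_ge0.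
have near1 : \forall n \near \oo, delta n < 1 by exact: (cvgr_lt 0).
have tC : \forall n \near \oo, tdelta n <= C * Num.sqrt (delta n).
  apply: filterS near1 => n dn1; rewrite /tdelta mulrC ler_wpM2r ?sqrtr_ge0//.
  rewrite lerD//; last by rewrite -[leRHS]sqrtr1 ler_wsqrtr// ltW.
  by rewrite ler_wpM2l// ler_wsqrtr// lerD2l; lra.
(* Eventually [tdelta n <= C], so [C] may replace [tdelta n] inside the bracket. *)
pose C' := C * (1 + (r + 2 * C) * (2 + 3 * C)).
have C'0 : 0 <= C'.
  by rewrite mulr_ge0// addr_ge0// mulr_ge0// addr_ge0// mulr_ge0.
have bC : \forall n \near \oo, bound n <= C' * Num.sqrt (delta n).
  apply: filterS2 near1 tC => n dn1 tn.
  have tn1 : tdelta n <= C.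
    apply: le_trans tn _; rewrite ler_piMr//.
    by rewrite -[leRHS]sqrtr1 ler_wsqrtr// ltW.
  rewrite /C' mulrAC ler_pM//.
    by rewrite addr_ge0// mulr_ge0// addr_ge0// mulr_ge0.
  by rewrite lerD2l ler_pM ?addr_ge0 ?mulr_ge0 ?lerD2l ?ler_wpM2l.
have bigO (u : nat -> R) (c : R) : 0 <= c -> (forall n, 0 <= u n) ->
    (\forall n \near \oo, u n <= c * Num.sqrt (delta n)) ->
    u =O_\oo (fun n => Num.sqrt (delta n)).
  (* The constant has to be strictly positive, hence [c + 1]. *)
  move=> c0 u0 uc; apply/eqO_exP; exists (c + 1); first by rewrite ltr_wpDl.
  apply: filterS uc => n un; rewrite !ger0_norm ?sqrtr_ge0//.
  by apply: le_trans un _; rewrite ler_wpM2r ?sqrtr_ge0// lerDl.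
split; [|exact: (bigO _ C')|exact: (bigO _ C)].
(* The bound itself serves as the convergence speed. *)
exists bound; split=> //; split=> //.
  split=> //; apply: (@squeeze_cvgr _ _ _ _ (fun=> 0)
    (fun n => C' * Num.sqrt (delta n))).
  - by apply: filterS bC => n; rewrite bound0.
  - exact: cvg_cst.
  - rewrite -(mulr0 C') -[X in C' * X](sqrtr0 R).
    apply: cvgM; first exact: cvg_cst.
    apply: (@continuous_cvg _ _ _ _ _ _ Num.sqrt) => //.
    exact: sqrt_continuous.
have dil n : exists2 io : {bounded H n -> sum_space H Hoo}, is_isometry io &
    opnorm ((io \o resolvent (A n) z0 \o adjoint io) \-
      (iota_oo H Hoo \o resolvent Aoo z0 \o adjoint (iota_oo H Hoo)))
      <= bound n.
  have [/opnormP J1 [/opnormP q1 /opnormP q2 /opnormP q3] qa] := JQ n.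
  have [q1a q2a] : (forall x, nrm (adjoint (resolvent (A n) z0) x -
      adjoint (J n) (J n (adjoint (resolvent (A n) z0) x)))
      <= delta n * nrm x) /\
    (forall x, nrm (adjoint (resolvent Aoo z0) x -
      J n (adjoint (J n) (adjoint (resolvent Aoo z0) x))) <= delta n * nrm x).
    have [z0r|z0r] := boolP (z0 \is Num.real).
      (* For real [z0] the resolvents equal their adjoints, so the plain estimates are the adjoint
         ones. *)
      by split=> x; rewrite resolvent_sym//; [exact: q1|exact: q2].
    by have [/opnormP q1' /opnormP q2' _] := qa z0r.
  have [P [W [PW PST WS WSa]]] := QUE_dilation (d0 n) r0 J1
    (nrm_opnorm (resolvent Aoo z0)) q1 q1a q2a q3.
  exists (iota_dilation PW); first exact: iota_dilation_isometry.
  apply: (@dilation_estimate _ _ _ _ P W PW _ _ (2 * delta n * (1 + r))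
    _ _ _ PST WS WSa) => //.
  - by rewrite !mulr_ge0// addr_ge0.
  - exact: b2_ge0.
  - by have [] := dilation_bound r0 (d0 n).
exists (sum_space H Hoo), (fun n => projT1 (cid2 (dil n))), (iota_oo H Hoo).
by split=> [n||n]; [case: cid2|exact: iota_oo_isometry|case: cid2].
Qed.
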